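(* Let $n\ge3$, and let $p$ and $r$ be exponents with $$p<\begin{cases}2+\dfrac{8}{3n-1}& \text{if } n \text{ is odd},\\[6pt] 2+\dfrac{8}{3n-2}&\text{if } n\text{ is even},\end{cases}\qquad\text{and}\qquad \frac{r}{r-1}\le\frac{n-2}{n}\,p .$$ Then there exist a phase $\phi$ and an amplitude $a$, satisfying the cinematic curvature condition (as defined in the context), such that for the associated operators $T^\lambda$ there is no constant $C$ for which $$\|T^\lambda f\|_{L^p(\mathbb R^n)}\le C\,\|f\|_{L^r(\mathbb R^{n-1})}$$ holds for all $\lambda\ge1$ and all $f\in L^r(\mathbb R^{n-1})$.
   Context: Write $x=(x',x_n)\in\mathbb R^{n-1}\times\mathbb R$, $\xi=(\xi',\xi_{n-1})\in\mathbb R^{n-2}\times\mathbb R$. $B^m_r(y)$ is the ball of radius $r$ centred at $y$ in $\mathbb R^m$. Let $\mathbb A=\{(\xi',\xi_{n-1})\in\mathbb R^{n-1}:1\le\xi_{n-1}\le 2,\ |\xi'|\le\xi_{n-1}\}$. Let $a\in C_c^\infty(\mathbb R^n\times\mathbb R^{n-1})$ be non-negative and supported in $B_1^n(0)\times\mathbb A$. A phase $\phi:B_1^n(0)\times\mathbb A\to\mathbb R$ and such an amplitude $a$ satisfy the cinematic curvature condition if: (H1) $\phi(x;\xi)$ is homogeneous of degree 1 in $\xi$ and smooth away from $\xi=0$. (H2) $\operatorname{rank}\partial^2_{x'\xi}\phi(x',x_n;\xi)=n-1$ for all $(x',x_n;\xi)\in\operatorname{supp}a$ with $\xi\ne0$.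 (H3) Let $G_0(x;\xi)=\bigwedge_{j=1}^{n-1}\partial_{\xi_j}\partial_x\phi(x;\xi)$ (the wedge of $n-1$ vectors of $\mathbb R^n$, identified with a vector of $\mathbb R^n$) and $G(x;\xi)=G_0(x;\xi)/|G_0(x;\xi)|\in S^{n-1}$ on $\operatorname{supp}a$. Then for all $(x,\xi_0)\in\operatorname{supp}a$ the matrix $\partial^2_{\xi\xi}\langle\partial_x\phi(x,\xi),G(x,\xi_0)\rangle|_{\xi=\xi_0}$ has rank $n-2$ with $n-2$ positive eigenvalues. For $\lambda\ge1$ let $a^\lambda(x;\xi)=a(x/\lambda;\xi)$, $\phi^\lambda(x;\xi)=\lambda\phi(x/\lambda;\xi)$ and $$T^\lambda f(x)=\int e^{-2\pi i\phi^\lambda(x;\xi)}a^\lambda(x;\xi)f(\xi)\,d\xi .$$ For $r=\infty$, $r/(r-1)$ is read as $1$. The amplitude constructed must be a non-negative function $a\in C_c^\infty(\mathbb R^n\times\mathbb R^{n-1})$ supported in $B_1^n(0)\times\mathbb A$ which together with $\phi$ satisfies (H1), (H2) and (H3), with $T^\lambda f(x)=\int e^{-2\pi i\phi^\lambda(x;\xi)}a^\lambda(x;\xi)f(\xi)\,d\xi$ (the paper takes $a$ to be a bump function equal to $1$ on an open set, so it is not identically zero). *)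

(* Defs.v *)
From HB Require Import structures.
From mathcomp Require Import all_boot all_order all_algebra.
From mathcomp Require Import all_classical all_reals all_analysis.
From mathcomp Require Export complex.

Set Implicit Arguments.
Unset Strict Implicit.
Unset Printing Implicit Defensive.
Import Order.TTheory GRing.Theory Num.Theory.
Import numFieldNormedType.Exports.

Local Open Scope classical_set_scope.
Local Open Scope ring_scope.

(* R^n is 'rV[R]_n. Its library norm is the sup norm, so the Euclidean norm
   is defined separately; both induce the same topology. *)
Definition enorm (R : realType) n (v : 'rV[R]_n) : R :=
  Num.sqrt (\sum_(i < n) v 0 i ^+ 2).

Definition eball (R : realType) n (y : 'rV[R]_n) (r : R) : set 'rV[R]_n :=
  [set x | enorm (x - y) < r].

(* R^n carries the sigma-algebra generated by the coordinates, that is, the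
   Borel sets; the measurable structure of n.-tuple R is built the same way. *)

Definition rV_display : measure_display -> measure_display.
Proof. exact. Qed.

Section measurable_rV.
Context {d} {T : measurableType d} (n : nat).

Let coord : 'I_n -> 'rV[T]_n -> T := fun i v => v ord0 i.

Let rV_set0 : g_sigma_preimage coord set0.
Proof. exact: sigma_algebra0. Qed.

Let rV_setC A : g_sigma_preimage coord A -> g_sigma_preimage coord (~` A).
Proof. exact: sigma_algebraC. Qed.

Let rV_bigcup (F : (set 'rV[T]_n)^nat) :
  (forall i, g_sigma_preimage coord (F i)) ->
  g_sigma_preimage coord (\bigcup_i (F i)).
Proof. exact: sigma_algebra_bigcup. Qed.

HB.instance Definition _ := @isMeasurable.Build (rV_display d)
  'rV[T]_n (g_sigma_preimage coord) rV_set0 rV_setC rV_bigcup.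

Lemma measurable_coord (i : 'I_n) :
  measurable_fun [set: 'rV[T]_n] (fun v : 'rV[T]_n => v ord0 i).
Proof.
move=> _ Y mY; rewrite setTI; apply: sub_sigma_algebra => /=.
rewrite -bigcup_seq/=; exists i => /=; first by rewrite mem_index_enum.
by exists Y => //; rewrite setTI.
Qed.

Lemma measurable_fun_rV d' (T' : measurableType d') (f : T' -> 'rV[T]_n) :
  (forall i, measurable_fun [set: T'] (fun x => f x ord0 i)) ->
  measurable_fun [set: T'] f.
Proof.
move=> mf _ A mA; rewrite setTI; move: A mA.
apply: (@smallest_sub _ _ _ [set A | measurable (f @^-1` A)]).
  split => /=; first by rewrite preimage_set0.
  - by move=> A mA; rewrite setTD preimage_setC; exact: measurableC.
  - by move=> F mF; rewrite preimage_bigcup; exact: bigcup_measurable.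
rewrite -bigcup_seq; apply: bigcup_sub => i _ A [B mB <-] /=.
rewrite setTI -comp_preimage -[X in measurable X]setTI.
exact: mf.
Qed.

End measurable_rV.

Section lebesgue_rV.
Context {R : realType}.

Section step.
Variables (n : nat) (mu : {sigma_finite_measure set 'rV[R]_n -> \bar R}).

Let cons_rV (z : measurableTypeR R * 'rV[R]_n) : 'rV[R]_n.+1 := row_mx z.1%:M z.2.

Let uncons_rV (v : 'rV[R]_n.+1) : measurableTypeR R * 'rV[R]_n :=
  (v 0 0, @rsubmx _ 1 1 n v).

Let measurable_uncons_rV : measurable_fun setT uncons_rV.
Proof.
apply/measurable_fun_pair; first exact: measurable_coord.
apply: measurable_fun_rV => j; under eq_fun do rewrite mxE.
exact: measurable_coord.
Qed.

Let measurable_cons_rV : measurable_fun setT cons_rV.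
Proof.
apply: measurable_fun_rV => i; rewrite /cons_rV.
under eq_fun do rewrite mxE.
case: (@fintype.split 1 n i) => j.
  under eq_fun do rewrite mxE (ord1 j) eqxx mulr1n.
  exact: measurable_fst.
exact: (measurableT_comp (measurable_coord j)).
Qed.

Let prod : {measure set (measurableTypeR R * 'rV[R]_n)%type -> \bar R} :=
  (@lebesgue_measure R \x mu)%E.

Definition lebesgue_rV_step : set 'rV[R]_n.+1 -> \bar R :=
  pushforward (@lebesgue_measure R \x mu)%E cons_rV.

Let pushforward_measure : {measure set 'rV[R]_n.+1 -> \bar R} :=
  measure_function_pushforward__canonical__measure_function_Measure
    prod measurable_cons_rV.

Let step0 : lebesgue_rV_step set0 = 0%E.
Proof. exact: (measure0 pushforward_measure). Qed.

Let step_ge0 A : (0 <= lebesgue_rV_step A)%E.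
Proof. exact: (measure_ge0 pushforward_measure). Qed.

Let step_sigma_additive : semi_sigma_additive lebesgue_rV_step.
Proof. exact: (@measure_semi_sigma_additive _ _ _ pushforward_measure). Qed.

HB.instance Definition _ := isMeasure.Build _ _ _ lebesgue_rV_step
  step0 step_ge0 step_sigma_additive.

Let sigma_finite_step : sigma_finite setT lebesgue_rV_step.
Proof.
have /sigma_finiteP[F [FT ndF mF]] := sigma_finiteT (@lebesgue_measure R).
have /sigma_finiteP[G [GT ndG mG]] := sigma_finiteT mu.
exists (fun i => uncons_rV @^-1` (F i `*` G i)).
  apply/esym; rewrite -subTset => v _ /=.
  have [i _ Fi] : (\bigcup_i F i) (uncons_rV v).1 by rewrite -FT.
  have [j _ Gj] : (\bigcup_i G i) (uncons_rV v).2 by rewrite -GT.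
  exists (maxn i j) => //; split => /=.
    by move: Fi; exact/subsetPset/ndF/leq_maxl.
  by move: Gj; exact/subsetPset/ndG/leq_maxr.
move=> i; have [mFi Fioo] := mF i; have [mGi Gioo] := mG i; split.
  rewrite -[X in measurable X]setTI; apply: measurable_uncons_rV => //.
  exact: measurableX.
rewrite /lebesgue_rV_step /pushforward -comp_preimage.
rewrite (_ : _ \o _ = id) ?preimage_id; last first.
  apply/funext => -[x v] /=; congr pair; last by rewrite row_mxKr.
  by rewrite /cons_rV mxE; case: splitP => // j _; rewrite mxE (ord1 j).
rewrite product_measure1E// lte_mul_pinfty// ge0_fin_numE//.
Qed.

HB.instance Definition _ := Measure_isSigmaFinite.Build _ _ _
  lebesgue_rV_step sigma_finite_step.

End step.

Fixpoint lebesgue_rV (n : nat) :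
    {sigma_finite_measure set 'rV[R]_n -> \bar R} :=
  match n with
  | 0 => [the sigma_finite_measure _ _ of \d_(0 : 'rV[R]_0)]
  | n'.+1 => [the sigma_finite_measure _ _ of lebesgue_rV_step (lebesgue_rV n')]
  end.

End lebesgue_rV.

Section complex_Lp.
Context {R : realType} {n : nat}.
Implicit Types f : 'rV[R]_n -> R[i].

Definition cmeasurable f : Prop :=
  measurable_fun setT (fun x => complex.Re (f x)) /\
  measurable_fun setT (fun x => complex.Im (f x)).

Definition cLnorm (p : \bar R) f : \bar R :=
  Lnorm (lebesgue_rV n) p (fun x => (Normc.normc (f x))%:E).

Definition in_Lp (p : \bar R) f : Prop :=
  cmeasurable f /\ (cLnorm p f < +oo)%E.

Definition cintegral f : R[i] :=
  Complex (\int[lebesgue_rV n]_x complex.Re (f x))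
    (\int[lebesgue_rV n]_x complex.Im (f x)).

End complex_Lp.

Definition expi (R : realType) (t : R) : R[i] := Complex (cos t) (sin t).

Section smooth.
Context {R : realType} {V : normedModType R}.
Implicit Types (f : V -> R) (vs : seq V).

Definition iter_derive vs f : V -> R := foldr (fun v g => 'D_v g) f vs.

(* f is C^oo on an open neighbourhood of S: there, all the iterated directional
   derivatives of f exist and are (Frechet) differentiable. *)
Definition smooth_near (S : set V) f : Prop :=
  exists U : set V, [/\ open U, S `<=` U &
    forall vs z, U z -> differentiable (iter_derive vs f) z].

Definition supp f : set V := closure [set z | f z != 0].

End smooth.

Section cinematic.
Context {R : realType} {k : nat}.

(* n = k + 2; phases and amplitudes are functions on R^n x R^(n-1), of which
   only the values on B_1(0) x sector matter for phases: the sector is the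
   closure of its interior, so they determine the derivatives there as well. *)
Local Notation Rn := 'rV[R]_k.+2.
Local Notation Rn1 := 'rV[R]_k.+1.
Implicit Types (phi a : Rn * Rn1 -> R) (x : Rn) (xi : Rn1).

(* The set $\mathbb A$; col' ord_max drops the last coordinate. *)
Definition sector : set Rn1 :=
  [set xi : Rn1 | 1 <= xi 0 ord_max <= 2 /\
                  enorm (col' ord_max xi) <= xi 0 ord_max].

Definition phase_domain : set (Rn * Rn1) := eball 0 1 `*` sector.

Definition is_amplitude a : Prop :=
  [/\ smooth_near setT a, compact (supp a), forall z, 0 <= a z
    & supp a `<=` phase_domain].

Definition dx (i : 'I_k.+2) (F : Rn * Rn1 -> R) : Rn * Rn1 -> R :=
  'D_((delta_mx 0 i, 0) : Rn * Rn1) F.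

Definition dxi (j : 'I_k.+1) (F : Rn * Rn1 -> R) : Rn * Rn1 -> R :=
  'D_((0, delta_mx 0 j) : Rn * Rn1) F.

Definition cinematic_H1 phi : Prop :=
  (forall x xi t, 0 < t -> phase_domain (x, xi) -> phase_domain (x, t *: xi) ->
     phi (x, t *: xi) = t * phi (x, xi)) /\
  smooth_near [set z : Rn * Rn1 | phase_domain z /\ z.2 != 0] phi.

(* lift ord_max identifies the coordinates of x' with the first n-1 of x. *)
Definition mixed_hessian phi (z : Rn * Rn1) : 'M[R]_k.+1 :=
  \matrix_(i, j) dx (lift ord_max i) (dxi j phi) z.

Definition cinematic_H2 phi a : Prop :=
  forall z, supp a z -> z.2 != 0 -> \rank (mixed_hessian phi z) = k.+1.

(* The vector identified with the wedge product of the n-1 rows v_1, ...,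
   v_(n-1) of V, i.e. the w with <w, u> = det (v_1, ..., v_(n-1), u) for all u:
   its coordinates are the cofactors along the last row. *)
Definition wedge (V : 'M[R]_(k.+1, k.+2)) : Rn :=
  \row_i ((-1) ^+ (k.+1 + i) * \det (col' i V)).

Lemma wedgeE (V : 'M[R]_(k.+1, k.+2)) (u : Rn) (M : 'M[R]_k.+2) :
  row' ord_max M = V -> row ord_max M = u ->
  \sum_i wedge V 0 i * u 0 i = \det M.
Proof.
move=> <- <-; rewrite (expand_det_row M ord_max); apply: eq_bigr => i _.
rewrite !mxE mulrC; congr (_ * _); rewrite /cofactor; congr (_ * _).
by congr (\det _); apply/matrixP => b c; rewrite !mxE.
Qed.

Definition normal_vec phi (z : Rn * Rn1) : Rn :=
  wedge (\matrix_(j < k.+1, i < k.+2) dxi j (dx i phi) z).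

Definition gauss_map phi (z : Rn * Rn1) : Rn :=
  (enorm (normal_vec phi z))^-1 *: normal_vec phi z.

Definition hessian (h : Rn1 -> R) xi : 'M[R]_k.+1 :=
  \matrix_(i, j) 'D_(delta_mx 0 i) ('D_(delta_mx 0 j) h) xi.

Definition curvature_matrix phi x xi0 : 'M[R]_k.+1 :=
  hessian
    (fun xi => \sum_(i < k.+2) dx i phi (x, xi) * gauss_map phi (x, xi0) 0 i)
    xi0.

(* s lists all the eigenvalues of M, with multiplicity. *)
Definition eigenvalue_list m (M : 'M[R]_m) (s : seq R) : Prop :=
  char_poly M = \prod_(z <- s) ('X - z%:P).

Definition cinematic_H3 phi a : Prop :=
  forall x xi0, supp a (x, xi0) ->
    \rank (curvature_matrix phi x xi0) = k /\
    exists2 s, eigenvalue_list (curvature_matrix phi x xi0) s &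
               count (fun z => 0 < z) s = k.

Definition cinematic_curvature phi a : Prop :=
  [/\ cinematic_H1 phi, cinematic_H2 phi a & cinematic_H3 phi a].

Definition rescaled_phase (lambda : R) phi (z : Rn * Rn1) : R :=
  lambda * phi (lambda^-1 *: z.1, z.2).

Definition rescaled_amplitude (lambda : R) a (z : Rn * Rn1) : R :=
  a (lambda^-1 *: z.1, z.2).

Definition oscillatory_op phi a (lambda : R) (f : Rn1 -> R[i]) (x : Rn) : R[i] :=
  cintegral (fun xi =>
    expi (- (2 * pi * rescaled_phase lambda phi (x, xi))) *
    (rescaled_amplitude lambda a (x, xi))%:C%C * f xi).

End cinematic.

(* Main.v *)
Require Import Defs.
From mathcomp Require Import all_boot all_order all_algebra.
From mathcomp Require Import all_classical all_reals all_analysis.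
From mathcomp Require Import measurable_realfun ess_sup_inf spectral ring lra zify.

Set Implicit Arguments.
Unset Strict Implicit.
Unset Printing Implicit Defensive.
Import Order.TTheory GRing.Theory Num.Theory.
Import numFieldNormedType.Exports.

Local Open Scope classical_set_scope.
Local Open Scope ring_scope.

(* The estimate is refuted with |f| <= 1 supported in a fixed box, so that every
   norm ||f||_r is at most 1 and only p matters. With u = xi' / eta, the phase is
   phi = x'.xi + <A(t) xi', xi'> / eta, where t = x_n and A(t) is diagonal with
   alternating entries 2 + t and - 1 / (2 + t), both increasing in t.
   For an antisymmetric B made of 2 x 2 blocks, each block of A(t) + B is
   [[2 + t, 1], [-1, - 1 / (2 + t)]], of rank one for every t. Cut the frequency
   box into cubes of side lambda^(-1/2) and modulate each of them so that the
   image of its indicator is large on the tube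
   x'' = - 2 lambda (A(t / lambda) + B) u. All these tubes lie in a set Y of
   measure lambda^(n - m/2), where m = floor((n - 2) / 2).
   By the parallelogram law, signs can be chosen so that the sum f of the wave
   packets has ||T f||_{L^2(Y)}^2 >= c lambda, and comparing u^2 with u^p above
   and below a threshold turns this into a lower bound for ||T f||_p, which is
   unbounded when p < 2 + 4 / (2 n - m - 2). *)

(** * Lebesgue measure of triangular tubes *)

(** The signs in [A] and [B] are forced. (H3) makes the diagonal entries of [A] increasing, while
    compression needs a block [[a, b], [c, d]] of [A + B] to be singular for every t, that is, a d =
    b c with b c constant. If a' and d' are positive, a' d + a d' = 0 makes a and d of opposite
    signs, so b c < 0: no symmetric [B] will do, and a = 2 + t, d = - 1 / a, b = - c = 1 is a simple
    solution without pole for |t| <= 1. Adding [B] costs nothing: modulating one packet translates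
    its tube by a constant vector and leaves the phase alone.

    The exponent comes from counting powers of N = lambda^(1/2). A packet has size N^(1-n) on a tube
    of measure N^(n+1), so the N^(n-1) packets have total energy N^2. With e = 2n - m - 2, the
    values of |T f| below V = c N^(-e/2) carry at most half of that energy on Y, and above V one has
    |T f|^2 <= V^(2-p) |T f|^p if p >= 2. Thus a bound for the operators would give N^2 <= C
    N^(e(p-2)/2) for all N, which fails if p < 2 + 4/e. *)

Section tube.
Context {R : realType}.

Definition tube n (g : 'I_n -> 'rV[R]_n -> R) (L : 'I_n -> R) : set 'rV[R]_n :=
  [set x : 'rV[R]_n | forall i, `|x 0 i - g i x| <= L i].

Lemma measurable_tube n (g : 'I_n -> 'rV[R]_n -> R) (L : 'I_n -> R) :
  (forall i, measurable_fun setT (g i)) -> measurable (tube g L).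
Proof.
move=> mg; rewrite /tube.
have -> : [set x : 'rV[R]_n | forall i, `|x 0 i - g i x| <= L i] =
    \big[setI/setT]_(i < n) ([set: 'rV[R]_n] `&` (fun x : 'rV[R]_n =>
      `|x 0 i - g i x|) @^-1` `]-oo, L i]).
  apply/seteqP; split => [x H | x].
    rewrite -bigcap_seq => i _ /=; split => //.
    by rewrite /= in_itv /= H.
  rewrite -bigcap_seq => H i; have := H i; rewrite /= mem_index_enum in_itv /=.
  by move=> /(_ isT) [].
apply: big_ind => //; first by move=> A B; exact: measurableI.
move=> i _.
suff : measurable_fun setT (fun x : 'rV[R]_n => `|x 0 i - g i x|) by apply.
apply: measurableT_comp => //; apply: measurable_funB => //.
exact: measurable_coord.
Qed.

(** The map by which [lebesgue_rV] adds a dimension; the new coordinate comes first. *)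
Definition consv n (s : R) (v : 'rV[R]_n) : 'rV[R]_n.+1 := @row_mx _ 1 1 n s%:M v.

Lemma consv0 n s (v : 'rV[R]_n) : consv s v 0 ord0 = s.
Proof.
by rewrite mxE; case: (splitP (ord0 : 'I_(1 + n))) => // j _;
  rewrite mxE (ord1 j) eqxx.
Qed.

Lemma consvS n s (v : 'rV[R]_n) i : consv s v 0 (lift ord0 i) = v 0 i.
Proof.
rewrite mxE; case: (splitP (lift ord0 i : 'I_(1 + n))) => j;
  first by rewrite (ord1 j).
by rewrite lift0 => -[ij]; congr (v 0 _); apply/val_inj.
Qed.

Lemma lebesgue_rVS n (A : set 'rV[R]_n.+1) : measurable A ->
  lebesgue_rV n.+1 A =
  (\int[lebesgue_rV n]_v lebesgue_measure [set s : R | A (consv s v)])%E.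
Proof.
move=> mA; rewrite /= /lebesgue_rV_step /pushforward.
set B := _ @^-1` A.
have mB : measurable B.
  rewrite -[B]setTI; suff : measurable_fun setT (fun z : measurableTypeR R *
    'rV[R]_n => consv z.1 z.2) by apply.
  apply: measurable_fun_rV => i.
  under eq_fun do rewrite mxE.
  case: (@fintype.split 1 n i) => j.
    under eq_fun do rewrite mxE (ord1 j) eqxx mulr1n.
    exact: measurable_fst.
  exact: (measurableT_comp (measurable_coord j)).
transitivity (\int[lebesgue_measure]_x fubini_F (lebesgue_rV n) (EFin \o \1_B) x)%E.
  by rewrite indic_fubini_tonelli_FE.
rewrite indic_fubini_tonelli// indic_fubini_tonelli_GE//.
apply: eq_integral => v _ /=; congr (lebesgue_measure _).
by apply/seteqP; split => s /=; rewrite /ysection /= inE.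
Qed.

(** A triangular shear preserves volume: once the later coordinates are frozen, coordinate 0 runs
    over an interval of length [2 * L ord0], and only its centre depends on them. Dependence on
    later coordinates is the convention that suits [lebesgue_rV], which splits off coordinate 0. *)
Lemma measure_tube n (g : 'I_n -> 'rV[R]_n -> R) (L : 'I_n -> R) :
  (forall i, measurable_fun setT (g i)) ->
  (forall (i : 'I_n) (x y : 'rV[R]_n), (forall j : 'I_n, (i < j)%N -> x 0 j = y 0 j) ->
    g i x = g i y) ->
  (forall i, 0 <= L i) ->
  lebesgue_rV n (tube g L) = (\prod_(i < n) (2 * L i))%:E.
Proof.
elim: n g L => [|n IH] g L mg dg L0.
  rewrite big_ord0 /= diracE mem_set//= /tube => i; first by case: i.
rewrite lebesgue_rVS; last exact: measurable_tube.
pose g' i (v : 'rV[R]_n) := g (lift ord0 i) (consv 0 v).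
pose L' i := L (lift ord0 i).
have gS i s v : g (lift ord0 i) (consv s v) = g' i v.
  apply: dg => j; case: (unliftP ord0 j) => [j' ->|-> //]; by rewrite !consvS.
have g0 s v : g ord0 (consv s v) = g ord0 (consv 0 v).
  apply: dg => j; case: (unliftP ord0 j) => [j' ->|-> //]; by rewrite !consvS.
have mrow : measurable_fun setT (fun v : 'rV[R]_n => consv 0 v).
  apply: measurable_fun_rV => i; case: (unliftP ord0 i) => [j ->|->].
    under eq_fun do rewrite consvS; exact: measurable_coord.
  under eq_fun do rewrite consv0; exact: measurable_cst.
have mg' i : measurable_fun setT (g' i) by apply: measurableT_comp.
have dg' (i : 'I_n) (x y : 'rV[R]_n) : (forall j : 'I_n, (i < j)%N -> x 0 j = y 0 j) ->
  g' i x = g' i y.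
  move=> H; apply: dg => j; case: (unliftP ord0 j) => [j' ->|-> //].
  by rewrite !consvS => /H.
have mT' := measurable_tube L' mg'.
rewrite big_ord_recl EFinM -(IH g' L')//; last by move=> i; exact: L0.
transitivity (\int[lebesgue_rV n]_v ((2 * L ord0) * \1_(tube g' L') v)%:E)%E.
  apply: eq_integral => v _; rewrite indicE; case: (boolP (v \in _)) => vT.
    rewrite mulr1 (_ : [set s | _] = `[g ord0 (consv 0 v) - L ord0,
      g ord0 (consv 0 v) + L ord0]%classic).
      rewrite lebesgue_measure_itv /= lte_fin -EFinD.
      have := L0 ord0; case: ifP; first by move=> *; congr (_%:E); ring.
      move=> /negbT; rewrite -leNgt => h1 h2; congr (_%:E).
      have -> : L ord0 = 0 by lra.
      by rewrite mulr0.
    apply/seteqP; split => s /=; rewrite in_itv /=.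
      move=> /(_ ord0); rewrite consv0 g0 ler_norml; lra.
    move=> H i; case: (unliftP ord0 i) => [i' ->|->].
      by rewrite consvS gS; move: vT; rewrite inE => /(_ i').
    rewrite consv0 g0 ler_norml; lra.
  rewrite mulr0 (_ : [set s | _] = set0) ?measure0//.
  apply/seteqP; split => s //= H; move: vT; rewrite notin_setE; apply => i.
  by have := H (lift ord0 i); rewrite consvS gS.
under eq_integral do rewrite EFinM.
rewrite ge0_integralZl_EFin //.
- by rewrite integral_indic ?setIT.
- exact/measurable_EFinP.
- by rewrite mulr_ge0.
Qed.
End tube.

(** * Smooth functions *)

Section flat_fun.
Context {R : realType}.
Implicit Types P : {poly R}.

Definition flat P (s : R) : R := if 0 < s then P.[s^-1] * expR (- s^-1) else 0.

Lemma pow_le_expR m (w : R) : 0 <= w -> w ^+ m <= m%:R ^+ m * expR w.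
Proof.
move=> w0; case: m => [|m]; first by rewrite !expr0 mul1r -expR0 ler_expR.
have -> : expR w = expR (w / m.+1%:R) ^+ m.+1.
  by rewrite -expRM_natl; congr expR; field.
rewrite -exprMn lerXn2r ?nnegrE ?mulr_ge0 ?expR_ge0//.
rewrite mulrC -ler_pdivrMr//.
apply: le_trans (expR_ge1Dx _); rewrite lerDr ler01//.
Qed.

(** The rate w^-2 is what differentiability of [flat] at 0 needs: with w = 1/h, it bounds the
    difference quotient by [C * h]. *)
Lemma poly_expR_bound P :
  exists C, forall w, 1 <= w -> `|P.[w]| * expR (- w) <= C / w ^+ 2.
Proof.
pose d := size P; pose S := (\sum_(i < d) `|P`_i|) : R.
exists (S * d.+2%:R ^+ d.+2) => w w1.
have w0 : 0 < w by lra.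
rewrite expRN ler_pdivrMr ?expR_gt0// mulrAC ler_pdivlMr ?exprn_gt0// -mulrA.
apply: le_trans (ler_wpM2l _ (pow_le_expR _ (ltW w0))); last by rewrite sumr_ge0.
rewrite -(addn2 d) exprD (mulrA S) ler_wpM2r ?exprn_ge0 ?(ltW w0)//.
rewrite horner_coef; apply: le_trans; first exact: ler_norm_sum.
rewrite mulr_suml ler_sum// => i _; rewrite normrM ler_wpM2l//.
by rewrite normrX gtr0_norm// ler_weXn2l// ltnW.
Qed.

Lemma is_derive_flat P (s : R) : is_derive s (1 : R) (flat P) (flat ('X^2 * (P -
  P^`())) s).
Proof.
have [s0|s0|->] := ltgtP s 0.
- have -> : flat ('X^2 * (P - P^`())) s = 0 by rewrite /flat ltNge ltW.
  apply: (@near_eq_is_derive _ _ _ (fun x => 0)).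
    near=> x; rewrite /flat ifF//; apply/negbTE; rewrite -leNgt ltW//.
    near: x; exact: lt_nbhsl.
- have sn0 : s != 0 by rewrite gt_eqF.
  have -> : flat ('X^2 * (P - P^`())) s = P.[s^-1] * (expR (- s^-1) * s ^- 2) +
    expR (- s^-1) * (- s ^- 2 * P^`().[s^-1]).
    by rewrite /flat s0 hornerM hornerXn hornerD hornerN; field.
  apply: (@near_eq_is_derive R R R (fun x : R => P.[x^-1] * expR (- x^-1))).
    near=> x; rewrite /flat ifT//; near: x; exact: lt_nbhsr.
  have dV : is_derive s (1 : R) (fun x => x^-1) (- s ^- 2).
    have := is_deriveV sn0 (is_derive_id s (1 : R)).
    by rewrite /GRing.scale /= mulr1.
  have dP := @is_derive1_comp _ (horner P) (fun x =>
    x^-1) _ _ _ (is_derive_poly P _) dV.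
  have dE := @is_derive1_comp _ expR (fun x =>
    - x^-1) _ _ _ (is_derive_expR _) (is_deriveN dV).
  by apply: (is_derive_eq (is_deriveM dP dE)); rewrite /GRing.scale /=; field.
- have [C HC] := poly_expR_bound P.
  have L : (fun h => h^-1 *: (flat P (h *: 1 + 0) - flat P 0)) @ (0:R)^' --> (0:R).
    apply: (@cvg_to_0_linear _ _ C 1) => // h /andP[h0 h1].
    rewrite /GRing.scale /= mulr1 addr0 /flat ltxx subr0.
    case: ifPn => hp; last first.
      rewrite mulr0 normr0; have := HC 1 (lexx _).
      rewrite expr1n divr1 => /(le_trans _) C0; apply: mulr_ge0 => //.
      by apply: C0; rewrite mulr_ge0 ?expR_ge0.
    rewrite gtr0_norm// in h1.
    have hw : 1 <= h^-1 by rewrite invf_ge1// ltW.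
    rewrite !normrM (gtr0_norm (expR_gt0 _)) (gtr0_norm hp) gtr0_norm ?invr_gt0//.
    rewrite mulrC ler_pdivrMr//; apply: (le_trans (HC _ hw)).
    by rewrite exprVn invrK expr2 mulrA.
  rewrite {2}/flat ltxx.
  apply: DeriveDef; first by apply/cvg_ex; exists 0.
  by rewrite /derive; exact: cvg_lim.
Unshelve. all: by end_near.
Qed.

Lemma flat1_ge0 s : 0 <= flat 1 s.
Proof. by rewrite /flat; case: ifP => // _; rewrite hornerE mul1r expR_ge0. Qed.

Lemma flat1_le1 s : flat 1 s <= 1.
Proof.
rewrite /flat; case: ifP => // s0; rewrite hornerE mul1r -expR0 ler_expR.
by rewrite oppr_le0 invr_ge0 ltW.
Qed.

Lemma flat1_gt0 s : (0 < flat 1 s) = (0 < s).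
Proof. by rewrite /flat; case: ifP; rewrite ?ltxx// hornerE mul1r expR_gt0. Qed.

Lemma le_flat1 s t : s <= t -> flat 1 s <= flat 1 t.
Proof.
move=> st; rewrite {1}/flat; case: ifPn => [s0|_]; last exact: flat1_ge0.
have t0 := lt_le_trans s0 st.
by rewrite /flat t0 !hornerC !mul1r ler_expR lerN2 lef_pV2.
Qed.

Lemma flat_continuous P : continuous (flat P).
Proof.
move=> s; apply: differentiable_continuous; apply/derivable1_diffP.
exact: (@ex_derive _ _ _ _ _ _ _ (is_derive_flat P s)).
Qed.
End flat_fun.

Lemma near_eq_differentiable (R : realType) (V : normedModType R)
    (f g : V -> R) z :
  (\near z, f z = g z) -> differentiable f z -> differentiable g z.
Proof.
move=> fg df; have cdf : continuous ('d f z) by exact: diff_continuous.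
have H : g \o shift z = cst (g z) + 'd f z +o_ 0 id.
  apply/eqaddoP => _/posnumP[e].
  have /eqaddoP/(_ e%:num) /(_ [gt0 of e%:num]) := diff_locally df.
  have fgz : f z = g z := nbhs_singleton fg.
  have : \forall h \near 0, f (h + z) = g (h + z).
    by move: fg; rewrite (near_shift 0); apply: filterS => h; rewrite /= subr0.
  apply: filter_app2; near=> h => fgh.
  rewrite -![(_ - _ : _ -> _) _]/(_ - _) -![(_ + _ : _ -> _) _]/(_ + _) /=.
  by rewrite -fgh /cst -fgz.
by apply/diff_locallyP; rewrite (diff_unique cdf H).
Unshelve. all: by end_near.
Qed.

Section elementary.
Context {R : realType} {V : normedModType R} (U : set V).
Implicit Types f g : V -> R.

(** A syntactic class stable under directional derivatives on [U], so that smoothness follows by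
    induction on the list of directions, without computing any iterated derivative. [elementary_lin]
    covers the coordinates. *)
Inductive elementary : (V -> R) -> Prop :=
| elementary_cst c : elementary (fun=> c)
| elementary_lin f : (forall z, differentiable f z) ->
    (forall v, exists c, forall z, 'D_v f z = c) -> elementary f
| elementaryD f g : elementary f -> elementary g ->
    elementary (fun z => f z + g z)
| elementaryM f g : elementary f -> elementary g ->
    elementary (fun z => f z * g z)
| elementaryV f : (forall z, U z -> f z != 0) -> elementary f ->
    elementary (fun z => (f z)^-1)
| elementary_flat P f : elementary f -> elementary (fun z => flat P (f z)).

Lemma elementary_differentiable f z :
  elementary f -> U z -> differentiable f z.
Proof.
move=> + Uz; elim=> {f} [c|f df _|f g _ df _ dg|f g _ df _ dg|f f0 _ df|P f _ df].
- exact: differentiable_cst.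
- exact: df.
- exact: (differentiableD df dg).
- exact: (differentiableM df dg).
- by apply: differentiableV => //; exact: f0.
- apply: (differentiable_comp df); apply/derivable1_diffP.
  exact: (@ex_derive _ _ _ _ _ _ _ (is_derive_flat P (f z))).
Qed.

Lemma elementary_derive f v : elementary f ->
  exists2 g, elementary g & forall z, U z -> 'D_v f z = g z.
Proof.
elim=> {f} [c|f df dcst|f g ef [f' ef' ff'] eg [g' eg' gg']
  |f g ef [f' ef' ff'] eg [g' eg' gg']|f f0 ef [f' ef' ff']|P f ef [f' ef' ff']].
- by exists (fun=> 0); [exact: elementary_cst|move=> z _; exact: derive_cst].
- have [c Hc] := dcst v; exists (fun=> c); first exact: elementary_cst.
  by move=> z _.
- exists (fun z => f' z + g' z); first exact: elementaryD.
  move=> z Uz; rewrite -ff'// -gg'//; apply: deriveD; apply: diff_derivable;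
    exact: elementary_differentiable.
- exists (fun z => f z * g' z + g z * f' z).
    by apply: elementaryD; apply: elementaryM.
  move=> z Uz; rewrite -ff'// -gg'//; apply: deriveM; apply: diff_derivable;
    exact: elementary_differentiable.
- exists (fun z => (-1) * (((f z)^-1 * (f z)^-1) * f' z)).
    apply: elementaryM; first exact: elementary_cst.
    by apply: elementaryM => //; apply: elementaryM; apply: elementaryV.
  move=> z Uz; rewrite deriveV; last 2 first.
    + exact: f0.
    + by apply: diff_derivable; exact: elementary_differentiable.
  by rewrite ff'// mulN1r /GRing.scale /= mulNr -expr2 exprVn.
- exists (fun z => f' z * flat ('X^2 * (P - P^`())) (f z)).
    by apply: elementaryM => //; apply: elementary_flat.
  move=> z Uz.
  have df := elementary_differentiable ef Uz.
  have dP := is_derive_flat P (f z).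
  have dfl : differentiable (flat P) (f z).
    apply/derivable1_diffP; exact: (@ex_derive _ _ _ _ _ _ _ dP).
  rewrite -[fun z => _]/(flat P \o f) deriveE; last exact: differentiable_comp.
  have dfz : 'd f z v = f' z by rewrite -deriveE// ff'.
  rewrite diff_comp//= dfz.
  rewrite -[f' z in LHS]mulr1 -[f' z * 1]/(f' z *: (1 : R)) linearZ /=.
  by rewrite -deriveE// (@derive_val _ _ _ _ _ _ _ dP).
Qed.

Lemma elementary_smooth f : open U -> elementary f ->
  forall vs z, U z -> differentiable (iter_derive vs f) z.
Proof.
move=> oU ef vs.
(* Iterated derivatives agree with elementary functions on [U] only; as [U] is open this is an
   equality of germs, enough for differentiability and for the next derivative. *)
suff [g eg fg] : exists2 g, elementary g & forall z, U z -> iter_derive vs f z = g z.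
  move=> z Uz; apply: near_eq_differentiable (elementary_differentiable eg Uz).
  by near=> y; rewrite fg//; near: y; exact: open_nbhs_nbhs.
elim: vs => [|v vs [g eg fg]]; first by exists f.
have [g' eg' gg'] := elementary_derive v eg; exists g' => // z Uz.
rewrite /= -gg'//; apply: near_eq_derive.
by near=> y; rewrite fg//; near: y; exact: open_nbhs_nbhs.
Unshelve. all: by end_near.
Qed.

Lemma elementary_sum (I : Type) (r : seq I) (F : I -> V -> R) :
  (forall i, elementary (F i)) -> elementary (fun z => \sum_(i <- r) F i z).
Proof.
move=> eF; elim: r => [|i r IH].
  by under eq_fun do rewrite big_nil; exact: elementary_cst.
by under eq_fun do rewrite big_cons; exact: elementaryD.
Qed.

Lemma elementary_prod (I : Type) (r : seq I) (F : I -> V -> R) :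
  (forall i, elementary (F i)) -> elementary (fun z => \prod_(i <- r) F i z).
Proof.
move=> eF; elim: r => [|i r IH].
  by under eq_fun do rewrite big_nil; exact: elementary_cst.
by under eq_fun do rewrite big_cons; exact: elementaryM.
Qed.

End elementary.

(** * Eigenvalues of Gram matrices *)

Section gram.
Import complex.
Local Open Scope sesquilinear_scope.

Lemma mxrank_diag (F : fieldType) n (d : 'rV[F]_n) :
  \rank (diag_mx d) = (\sum_(i < n) (d 0%R i != 0%R))%N.
Proof.
elim: n d => [|n IH] d; first by rewrite big_ord0 flatmx0 mxrank0.
have -> : \rank (diag_mx d) =
    (\rank (diag_mx (@lsubmx F 1 1 n d)) + \rank (diag_mx (@rsubmx F 1 1 n d)))%N.
  by rewrite -rank_diag_block_mx -diag_mx_row hsubmxK.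
rewrite IH big_ord_recl; congr (_ + _)%N.
  rewrite rank_rV; congr (nat_of_bool (~~ _));
    apply/eqP/eqP => [/matrixP/(_ 0 0)|d0].
    by rewrite !mxE eqxx mulr1n => <-; congr (d 0 _); apply/val_inj.
  apply/matrixP => i j; rewrite !mxE !ord1 eqxx mulr1n -d0.
  by congr (d 0 _); apply/val_inj.
by apply: eq_bigr => i _; rewrite mxE; congr (nat_of_bool (d 0 _ != 0));
  apply/val_inj.
Qed.

Lemma char_poly_conj (F : fieldType) n (P A : 'M[F]_n) : P \in unitmx ->
  char_poly (invmx P *m A *m P) = char_poly A.
Proof.
move=> uP; pose Q := map_mx polyC P.
have uQ : Q \in unitmx by rewrite map_unitmx.
rewrite /char_poly; have -> : char_poly_mx (invmx P *m A *m P) =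
    invmx Q *m char_poly_mx A *m Q.
  rewrite /char_poly_mx !map_mxM /= map_invmx -/Q mulmxBr mulmxBl; congr (_ - _).
  by rewrite mul_mx_scalar -scalemxAl mulVmx// scalemx1.
by rewrite !det_mulmx det_inv mulrAC mulVr ?mul1r.
Qed.

(** The matrix is diagonalised over the complex numbers by the spectral theorem. Its eigenvalues are
    nonnegative, hence real, so the characteristic polynomial already splits over [R], and the
    positive eigenvalues are the nonzero ones, which the rank counts. *)
Lemma gram_eigenvalues (R : rcfType) m n (W : 'M[R]_(m, n)) :
  exists2 s : seq R, char_poly (W^T *m W) = \prod_(z <- s) ('X - z%:P) &
    count (fun z => 0 < z) s = \rank (W^T *m W).
Proof.
pose f : {rmorphism R -> R[i]} := real_complex R.
pose A := map_mx f (W^T *m W); pose Wc := map_mx f W.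
have fJ x : Num.conj (f x) = f x by apply/eqP; rewrite eq_complex /= oppr0 !eqxx.
have AE : A = Wc^T *m Wc by rewrite /A map_mxM map_trmx.
have WcE : Wc^t* = Wc^T by apply/matrixP => i j; rewrite !mxE fJ.
have AJ : A^t* = A by rewrite /A; apply/matrixP => i j; rewrite !mxE fJ; congr (f _);
  apply: eq_bigr => l _; rewrite !mxE mulrC.
have /orthomx_spectralP : A \is normalmx by apply/normalmxP; rewrite AJ.
set P := spectralmx A; set d := spectral_diag A => Ad.
have uP : P \is unitarymx := spectral_unitarymx A.
have uP' : P \in unitmx := unitarymx_unit uP.
(* The diagonal form is [Z] times its adjoint, so each eigenvalue is a sum of squared moduli. *)
pose Z := P *m Wc^T.
have ZE : diag_mx d = Z *m Z^t*.
  rewrite /Z trmx_mul map_mxM trmxK.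
  have -> : map_mx Num.conj Wc = Wc by apply/matrixP => i j; rewrite !mxE fJ.
  rewrite mulmxA -(mulmxA P) -AE Ad -(invmx_unitary uP) !mulmxA mulmxV// mul1mx.
  by rewrite -mulmxA mulmxV// mulmx1.
have d0 i : 0 <= d 0 i.
  have /matrixP/(_ i i) := ZE; rewrite !mxE eqxx mulr1n => ->.
  by apply: sumr_ge0 => j _; rewrite !mxE mul_conjC_ge0.
have dR i : d 0 i = f (complex.Re (d 0 i)).
  by have := d0 i; case: (d 0 i) => a b; rewrite lecE /= => /andP[/eqP -> _].
exists [seq complex.Re (d 0 i) | i <- enum 'I_n].
  apply: (map_poly_inj f); rewrite map_char_poly -/A Ad char_poly_conj//.
  rewrite char_poly_trig ?diag_mx_is_trig// rmorph_prod /= big_map.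
  rewrite big_enum /=; apply: eq_bigr => i _.
  by rewrite rmorphB /= map_polyX map_polyC /= -dR mxE eqxx mulr1n.
have <- : \rank A = \rank (W^T *m W) by rewrite /A mxrank_map.
have -> : \rank A = \rank (diag_mx d).
  rewrite Ad mxrankMfree ?row_free_unit// eqmxMfull//.
  by rewrite row_full_unit unitmx_inv.
rewrite mxrank_diag count_map -sum1_count big_enum_cond /= big_mkcond /=.
apply: eq_bigr => i _ /=; rewrite [in RHS]dR -(rmorph0 f) (inj_eq (fmorph_inj f)).
have : 0 <= complex.Re (d 0 i) by have := d0 i; rewrite {1}dR ler0c.
by rewrite le0r lt0r; case: eqP => //= _ ->.
Qed.
End gram.

(** * The phase *)

Section derivatives.
Context {R : realType}.

(** Affineness is asked along one line only; this applies to the phase in the direction of a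
    coordinate of x', although the phase is not affine. *)
Lemma is_derive_affine (V : normedModType R) (f : V -> R) z v c :
  (forall h, f (h *: v + z) = h * c + f z) -> is_derive z v f c.
Proof.
move=> H.
have E (h : R) : h != 0 -> h^-1 *: ((f \o shift z) (h *: v) - f z) = c.
  by move=> h0; rewrite /= H addrK /GRing.scale /= mulKf.
apply: DeriveDef.
  apply: (is_cvg_near_cst c); near=> h.
  by apply: E; near: h; exact: nbhs_dnbhs_neq.
apply/lim_near_cst => //; near=> h.
by apply: E; near: h; exact: nbhs_dnbhs_neq.
Unshelve. all: by end_near.
Qed.

Lemma differentiable_fst_coord m n (z : 'rV[R]_m * 'rV[R]_n) i :
  differentiable (fun z : 'rV[R]_m * 'rV[R]_n => z.1 0 i) z.
Proof.
apply: (@differentiable_comp _ _ _ _ fst (fun x : 'rV[R]_m => x 0 i)).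
  by apply: linear_differentiable => x; exact: cvg_fst.
exact: differentiable_coord.
Qed.

Lemma differentiable_snd_coord m n (z : 'rV[R]_m * 'rV[R]_n) j :
  differentiable (fun z : 'rV[R]_m * 'rV[R]_n => z.2 0 j) z.
Proof.
apply: (@differentiable_comp _ _ _ _ snd (fun x : 'rV[R]_n => x 0 j)).
  by apply: linear_differentiable => x; exact: cvg_snd.
exact: differentiable_coord.
Qed.

Lemma elementary_fst m n (U : set ('rV[R]_m * 'rV[R]_n)) i :
  elementary U (fun z => z.1 0 i).
Proof.
apply: elementary_lin => [z|v]; first exact: differentiable_fst_coord.
exists (v.1 0 i) => z; apply: derive_val; apply: is_derive_affine => h.
by rewrite /= !mxE.
Qed.

Lemma elementary_snd m n (U : set ('rV[R]_m * 'rV[R]_n)) j :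
  elementary U (fun z => z.2 0 j).
Proof.
apply: elementary_lin => [z|v]; first exact: differentiable_snd_coord.
exists (v.2 0 j) => z; apply: derive_val; apply: is_derive_affine => h.
by rewrite /= !mxE.
Qed.

Lemma derive_snd m n (F : 'rV[R]_m * 'rV[R]_n ->
  R) (x : 'rV[R]_m) (xi w : 'rV[R]_n) :
  'D_((0, w) : 'rV[R]_m * 'rV[R]_n) F (x, xi) = 'D_w (fun xi => F (x, xi)) xi.
Proof.
rewrite /derive.
have -> // : (fun h : R => h^-1 *: ((F \o shift (x, xi)) (h *: ((0,
  w) : 'rV[R]_m * 'rV[R]_n)) - F (x, xi))) =
  (fun h : R => h^-1 *: (((fun xi => F (x, xi)) \o shift xi) (h *: w) - F (x, xi))).
apply/funext => h /=; congr (_ *: (F _ - _)).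
by congr pair; rewrite /= scaler0 add0r.
Qed.

Lemma is_derive_coord n (x w : 'rV[R]_n) i :
  is_derive x w (fun x : 'rV[R]_n => x 0 i) (w 0 i).
Proof. by apply: is_derive_affine => h; rewrite !mxE. Qed.

Variables (k : nat) (e : 'I_k -> R).

Definition slope (xi : 'rV[R]_k.+1) i := xi 0 (lift ord_max i) / xi 0 ord_max.

Definition cone (xi : 'rV[R]_k.+1) : R :=
  (\sum_(i < k) e i * xi 0 (lift ord_max i) ^+ 2) / xi 0 ord_max.

Definition dcone (v xi : 'rV[R]_k.+1) : R :=
  \sum_(i < k) e i * (2 * slope xi i * v 0 (lift ord_max i) - slope xi i ^+ 2 * v 0
    ord_max).

(** The second derivative, factored: [v_i - slope_i * v_last] is, up to the factor 1/eta, the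
    derivative of the slope. This product form exhibits the Hessian as a Gram matrix. *)
Definition ddcone (w v xi : 'rV[R]_k.+1) : R :=
  \sum_(i < k) 2 * e i / xi 0 ord_max * (v 0 (lift ord_max i) - slope xi i * v 0
    ord_max)
    * (w 0 (lift ord_max i) - slope xi i * w 0 ord_max).

Lemma is_derive_slope (xi w : 'rV[R]_k.+1) i : xi 0 ord_max != 0 ->
  is_derive xi w (fun xi => slope xi i)
    ((w 0 (lift ord_max i) - slope xi i * w 0 ord_max) / xi 0 ord_max).
Proof.
move=> xi0; rewrite /slope.
have dV : is_derive xi w (fun xi : 'rV[R]_k.+1 => (xi 0 ord_max)^-1)
    (- (xi 0 ord_max) ^- 2 * w 0 ord_max).
  have [dx <-] := is_derive_coord xi w ord_max.
  by apply: DeriveDef; [exact: derivableV|rewrite deriveV].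
apply: (is_derive_eq (is_deriveM (is_derive_coord xi w (lift ord_max i)) dV)).
by rewrite /GRing.scale /=; field.
Qed.

Lemma is_derive_cone (xi v : 'rV[R]_k.+1) : xi 0 ord_max != 0 ->
  is_derive xi v cone (dcone v xi).
Proof.
move=> xi0.
have -> : cone = \sum_(i < k) (fun xi : 'rV[R]_k.+1 =>
  e i * (xi 0 (lift ord_max i) * slope xi i)).
  apply/funext => x; rewrite fct_sumE /cone mulr_suml; apply: eq_bigr => i _.
  by rewrite /slope expr2 !mulrA.
apply: is_derive_sum => i.
by apply: (is_derive_eq (is_deriveZ (e i) (is_deriveM (is_derive_coord xi v (lift
  ord_max i))
  (is_derive_slope v i xi0)))); rewrite /GRing.scale /= /slope; congr (_ * _); field.
Qed.

Lemma is_derive_dcone (xi v w : 'rV[R]_k.+1) : xi 0 ord_max != 0 ->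
  is_derive xi w (dcone v) (ddcone w v xi).
Proof.
move=> xi0.
have -> : dcone v = \sum_(i < k) (fun xi : 'rV[R]_k.+1 =>
   e i * (2 * v 0 (lift ord_max i) * slope xi i +
     (- v 0 ord_max) * (slope xi i * slope xi i))).
  apply/funext => x; rewrite fct_sumE; apply: eq_bigr => i _.
  by congr (_ * _); ring.
apply: is_derive_sum => i.
have ds := is_derive_slope w i xi0.
by apply: (is_derive_eq (is_deriveZ (e i) (is_deriveD (is_deriveZ (2 * v 0 (lift
  ord_max i)) ds)
  (is_deriveZ (- v 0 ord_max) (is_deriveM ds ds))))); rewrite /GRing.scale /=; field.
Qed.

End derivatives.

Section phase.
Context {R : realType} (k : nat).
Local Notation Rn := 'rV[R]_k.+2.
Local Notation Rn1 := 'rV[R]_k.+1.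

(** The diagonal of [A(t)]. An even entry times an odd one is -1, and [2 + t] stays positive on the
    unit ball. *)
Definition dil (i : nat) (t : R) : R := if odd i then - (2 + t)^-1 else 2 + t.

Definition dil' (i : nat) (t : R) : R := if odd i then (2 + t) ^- 2 else 1.

Lemma is_derive_dil i (t : R) : 2 + t != 0 -> is_derive t (1 : R) (dil i) (dil' i t).
Proof.
move=> t0; have d2 : is_derive t (1 : R) (fun t => 2 + t) (1 : R).
  by apply: is_derive_affine => h; rewrite /GRing.scale /= addrCA.
rewrite /dil /dil'; case: ifP => _ //.
by apply: (is_derive_eq (is_deriveN (is_deriveV t0 d2)));
  rewrite /GRing.scale /= mulr1 opprK.
Qed.

Lemma dil'_gt0 i t : 0 < 2 + t -> 0 < dil' i t.
Proof. by rewrite /dil' => t0; case: ifP => // _; rewrite invr_gt0 exprn_gt0. Qed.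

Definition phase (z : Rn * Rn1) : R :=
  \sum_(j < k.+1) z.1 0 (lift ord_max j) * z.2 0 j
  + cone (fun i : 'I_k => dil i (z.1 0 ord_max)) z.2.

Definition phase_smooth_domain : set (Rn * Rn1) :=
  [set z : Rn * Rn1 | -2 < z.1 0 ord_max] `&` [set z : Rn * Rn1 | 0 < z.2 0 ord_max].

Lemma open_phase_smooth_domain : open phase_smooth_domain.
Proof.
apply: openI.
  apply: (@open_comp _ _ (fun z : Rn * Rn1 => z.1 0 ord_max) [set t | -2 < t]);
    last exact: open_gt.
  by move=> z _; apply: differentiable_continuous; exact: differentiable_fst_coord.
apply: (@open_comp _ _ (fun z : Rn * Rn1 => z.2 0 ord_max) [set t | 0 < t]);
  last exact: open_gt.
by move=> z _; apply: differentiable_continuous; exact: differentiable_snd_coord.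
Qed.

Lemma elementary_phase : elementary phase_smooth_domain phase.
Proof.
have e2 : elementary phase_smooth_domain (fun z : Rn * Rn1 => 2 + z.1 0 ord_max).
  by apply: elementaryD; [exact: elementary_cst|exact: elementary_fst].
apply: elementaryD.
  by apply: elementary_sum => j; apply: elementaryM;
    [exact: elementary_fst|exact: elementary_snd].
apply: elementaryM; last first.
  by apply: elementaryV; [move=> z [_ /= /gt_eqF ->]|exact: elementary_snd].
apply: elementary_sum => i; apply: elementaryM; last first.
  by apply: elementaryM; exact: elementary_snd.
rewrite /dil; case: (odd i); last exact: e2.
under eq_fun do rewrite -mulN1r.
apply: elementaryM; first exact: elementary_cst.
by apply: elementaryV => // z [/= z1 _]; apply/eqP; lra.
Qed.

Lemma enorm_coord n (x : 'rV[R]_n) i : `|x 0 i| <= enorm x.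
Proof.
rewrite -sqrtr_sqr /enorm ler_wsqrtr// (bigD1 i)//= lerDl sumr_ge0// => j _.
exact: sqr_ge0.
Qed.

Lemma phase_domain_smooth : phase_domain `<=` phase_smooth_domain.
Proof.
move=> [x xi] [/= xB [/andP[xi1 _] _]]; split => /=; last by lra.
have := le_lt_trans (enorm_coord (x - 0) ord_max) xB.
by rewrite subr0 ltr_norml => /andP[+ _]; lra.
Qed.

Lemma cone_homogeneous (e : 'I_k -> R) t xi : t != 0 ->
  cone e (t *: xi) = t * cone e xi.
Proof.
move=> t0; rewrite /cone mxE.
under eq_bigr do rewrite mxE exprMn mulrCA.
by rewrite -mulr_sumr invfM expr2 -!mulrA; congr (t * _);
  rewrite mulrCA mulVKf // mulrC.
Qed.

Lemma phase_H1 : cinematic_H1 phase.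
Proof.
split=> [x xi t t0 _ _|].
  rewrite /phase /= cone_homogeneous ?gt_eqF// mulrDr; congr (_ + _).
  by rewrite mulr_sumr; apply: eq_bigr => j _; rewrite mxE mulrCA.
exists phase_smooth_domain; split.
- exact: open_phase_smooth_domain.
- by move=> z [/phase_domain_smooth].
- exact: elementary_smooth open_phase_smooth_domain elementary_phase.
Qed.

Lemma dx_phase (x : Rn) (xi : Rn1) i : dx (lift ord_max i) phase (x, xi) = xi 0 i.
Proof.
apply: derive_val; apply: is_derive_affine => h.
rewrite /phase /= !mxE !scaler0 !add0r (negPf (neq_lift _ _)) mulr0 add0r addrA.
congr (_ + _); rewrite (bigD1 i)//= [in RHS](bigD1 i)//= !mxE !eqxx /= mulr1.
rewrite mulrDl -!addrA; congr (_ + (_ + _)); apply: eq_bigr => j ji.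
by rewrite !mxE (inj_eq lift_inj) (negPf ji) mulr0 add0r.
Qed.

Lemma dx_phase_last (x : Rn) (xi : Rn1) : 2 + x 0 ord_max != 0 ->
  dx ord_max phase (x, xi) = cone (fun i : 'I_k => dil' i (x 0 ord_max)) xi.
Proof.
move=> x0.
pose psi (t : R) := cone (fun i : 'I_k => dil i t) xi.
have dpsi : is_derive (x 0 ord_max) (1 : R) psi (cone (fun i : 'I_k =>
  dil' i (x 0 ord_max)) xi).
  have -> : psi = \sum_(i < k) (fun t =>
    (xi 0 (lift ord_max i) ^+ 2 / xi 0 ord_max) * dil i t).
    apply/funext => t; rewrite fct_sumE /psi /cone mulr_suml; apply: eq_bigr => i _.
    by rewrite -mulrA mulrC.
  have -> : cone (fun i : 'I_k => dil' i (x 0 ord_max)) xi =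
      \sum_(i < k) (xi 0 (lift ord_max i) ^+ 2 / xi 0 ord_max) *: dil' i (x 0
        ord_max).
    rewrite /cone mulr_suml; apply: eq_bigr => i _.
    by rewrite /GRing.scale /= -mulrA mulrC.
  by apply: is_derive_sum => i; apply: is_deriveZ; exact: is_derive_dil.
rewrite -(@derive_val _ _ _ _ _ _ _ dpsi) /dx /derive.
have -> // : (fun h : R => h^-1 *: ((phase \o shift (x,
  xi)) (h *: ((delta_mx 0 ord_max, 0) : Rn * Rn1)) - phase (x, xi))) =
  (fun h : R => h^-1 *: ((psi \o shift (x 0 ord_max)) (h *: 1) - psi (x 0 ord_max))).
apply/funext => h; congr (_ *: _); rewrite /phase /= scaler0 add0r.
rewrite !mxE !eqxx /= -/(psi _).
under eq_bigr do rewrite !mxE eq_sym (negPf (neq_lift _ _)) mulr0 add0r.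
by rewrite /psi; ring.
Qed.

Lemma dxi_phase (x : Rn) (xi : Rn1) j : xi 0 ord_max != 0 ->
  dxi j phase (x, xi) =
  x 0 (lift ord_max j) + dcone (fun i : 'I_k =>
    dil i (x 0 ord_max)) (delta_mx 0 j) xi.
Proof.
move=> xi0; rewrite /dxi derive_snd; apply: derive_val.
have dl : is_derive xi (delta_mx 0 j : Rn1)
    (fun xi : Rn1 => \sum_(j < k.+1) x 0 (lift ord_max j) * xi 0 j) (x 0 (lift
      ord_max j)).
  apply: is_derive_affine => h.
  under eq_bigr do rewrite !mxE mulrDr eqxx /=.
  rewrite big_split /=; congr (_ + _);
    rewrite (bigD1 j)//= big1 ?addr0 ?eqxx ?mulr1 1?mulrC//.
  by move=> i /negPf ->; rewrite !mulr0.
exact: (is_deriveD dl (is_derive_cone (fun i : 'I_k =>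
  dil i (x 0 ord_max)) (delta_mx 0 j) xi0)).
Qed.

(** The variables x' enter only through x'.xi; the nonlinear term depends on x_n and xi alone. *)
Lemma mixed_hessian_phase (z : Rn * Rn1) : phase_smooth_domain z ->
  mixed_hessian phase z = 1%:M.
Proof.
case: z => x xi Uz; apply/matrixP => i j; rewrite !mxE /dx.
rewrite (@near_eq_derive _ _ _ _ (fun z : Rn * Rn1 => z.1 0 (lift ord_max j)
   + dcone (fun i : 'I_k => dil i (z.1 0 ord_max)) (delta_mx 0 j) z.2)); last first.
  have : \forall z \near (x, xi), phase_smooth_domain z.
    by apply: open_nbhs_nbhs; split => //; exact: open_phase_smooth_domain.
  by apply: filterS => -[y eta] [_ /= eta0]; rewrite dxi_phase// gt_eqF.
apply: derive_val; apply: is_derive_affine => h.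
rewrite /= !mxE scaler0 add0r (negPf (neq_lift _ _)) mulr0 add0r addrA;
  congr (_ + _).
by rewrite eqxx (inj_eq lift_inj) eq_sym.
Qed.

Lemma phase_H2 a : is_amplitude a -> cinematic_H2 phase a.
Proof.
move=> [_ _ _ sa] z /sa/phase_domain_smooth zU _.
by rewrite mixed_hessian_phase ?mxrank1.
Qed.

(** The last cofactor is the determinant of an identity block. Only this component of the normal
    matters for the curvature, since the derivatives of the phase in x' are linear in xi; its sign
    decides the sign of the eigenvalues. *)
Lemma normal_vec_last (x : Rn) (xi : Rn1) : normal_vec phase (x, xi) 0 ord_max = 1.
Proof.
rewrite mxE /= -signr_odd addnn odd_double expr0 mul1r.
rewrite [col' _ _](_ : _ = (1%:M : 'M[R]_(k.+1))) ?det1//; apply/matrixP => j i;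
  rewrite !mxE.
rewrite /dxi (_ : dx (lift ord_max i) phase = fun z => z.2 0 i); last first.
  by apply/funext => -[y eta]; rewrite dx_phase.
by apply: derive_val; apply: is_derive_affine => h; rewrite /= !mxE eqxx eq_sym.
Qed.

Lemma gauss_map_last_gt0 (x : Rn) (xi : Rn1) : 0 < gauss_map phase (x, xi) 0 ord_max.
Proof.
rewrite mxE normal_vec_last mulr1 invr_gt0.
apply: lt_le_trans (enorm_coord _ ord_max); by rewrite normal_vec_last normr1.
Qed.

(* A square root of the curvature matrix: its rows are the gradients of
   [xi_i / eta], up to positive factors. *)
Definition curvature_sqrt (c : 'I_k -> R) (u : 'I_k -> R) : 'M[R]_(k, k.+1) :=
  \matrix_(i, j) (c i * ((j == lift ord_max i)%:R - u i * (j == ord_max)%:R)).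

(** Paired with the fixed normal [G], the x-gradient of the phase is a linear form in xi plus [G_n]
    times the cone with coefficients [dil']. Its Hessian is therefore a sum of squares of linear
    forms with positive weights, and [c] collects the square roots of the weights. *)
Lemma curvature_matrix_phase (x : Rn) (xi : Rn1) : phase_smooth_domain (x, xi) ->
  let c i := Num.sqrt (gauss_map phase (x, xi) 0 ord_max *
      (2 * dil' i (x 0 ord_max) / xi 0 ord_max)) in
  curvature_matrix phase x xi =
  (curvature_sqrt c (slope xi))^T *m curvature_sqrt c (slope xi).
Proof.
move=> [x2 xi0]; rewrite /= in x2 xi0.
have := gauss_map_last_gt0 x xi; rewrite /curvature_matrix.
move: (gauss_map phase (x, xi)) => G G0.
have x20 : 2 + x 0 ord_max != 0 by apply/eqP; lra.
pose e (i : 'I_k) := dil' i (x 0 ord_max).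
apply/matrixP => i j; rewrite !mxE.
have dL (y : Rn1) : y 0 ord_max != 0 -> is_derive y (delta_mx 0 j : Rn1)
    (fun y => \sum_(l < k.+2) dx l phase (x, y) * G 0 l)
    (G 0 (lift ord_max j) + G 0 ord_max * dcone e (delta_mx 0 j) y).
  move=> y0.
  have -> : (fun y => \sum_(l < k.+2) dx l phase (x, y) * G 0 l) =
     (fun y : Rn1 => \sum_(l < k.+1) y 0 l * G 0 (lift ord_max l)) +
       (G 0 ord_max \*: (cone e : Rn1 -> R)).
    apply/funext => y'; rewrite (bigD1_ord ord_max)//= dx_phase_last// addrC.
    congr (_ + _); last by rewrite mulrC.
    by apply: eq_bigr => l _; rewrite dx_phase.
  have d1 : is_derive y (delta_mx 0 j : Rn1)
      (fun y : Rn1 => \sum_(l < k.+1) y 0 l * G 0 (lift ord_max l)) (G 0 (lift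
        ord_max j)).
    apply: is_derive_affine => h.
    under eq_bigr do rewrite !mxE mulrDl eqxx /=.
    rewrite big_split /=; congr (_ + _);
      rewrite (bigD1 j)//= big1 ?addr0 ?eqxx ?mulr1//.
    by move=> l /negPf ->; rewrite mulr0 mul0r.
  exact: (is_deriveD d1 (is_deriveZ (G 0 ord_max) (is_derive_cone e (delta_mx 0 j)
    y0))).
rewrite (@near_eq_derive _ _ _ _ (fun y =>
  G 0 (lift ord_max j) + G 0 ord_max * dcone e (delta_mx 0 j) y)); last first.
  have : \forall y \near xi, 0 < (y : Rn1) 0 ord_max.
    apply: open_nbhs_nbhs; split => //.
    apply: (@open_comp _ _ (fun y : Rn1 => y 0 ord_max) [set t | 0 < t]);
      last exact: open_gt.
    by move=> y _; exact: coord_continuous.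
  by apply: filterS => y y0; apply: derive_val; apply: dL; rewrite gt_eqF.
have xin0 : xi 0 ord_max != 0 by rewrite gt_eqF.
rewrite (@derive_val _ _ _ _ _ _ _ (is_deriveD (is_derive_cst (G 0 (lift ord_max j))
  xi (delta_mx 0 i : Rn1))
  (is_deriveZ (G 0 ord_max) (is_derive_dcone e (delta_mx 0 j) (delta_mx 0 i : Rn1)
    xin0)))).
rewrite add0r /GRing.scale /= mulr_sumr; apply: eq_bigr => l _.
rewrite !mxE !eqxx /=.
(* The radicand is nonnegative because [dil'] is positive: here the monotonicity of both kinds of
   entries of [A] is used. *)
rewrite [RHS]mulrACA -expr2 sqr_sqrtr; last first.
  rewrite mulr_ge0 ?(ltW G0)// divr_ge0 ?(ltW xi0)// mulr_ge0//.
  by rewrite ltW// dil'_gt0//; lra.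
rewrite -/(e l) !(eq_sym (lift ord_max l)) !(eq_sym ord_max) -!mulrA;
  congr (_ * (_ * (_ * (_ * _)))).
by rewrite mulrC.
Qed.

Lemma curvature_sqrt_free (c u : 'I_k -> R) : (forall i, c i != 0) ->
  row_free (curvature_sqrt c u).
Proof.
move=> c0; apply/row_freeP.
exists (\matrix_(j, i) ((c i)^-1 * (j == lift ord_max i)%:R)).
apply/matrixP => i l; rewrite !mxE (bigD1 (lift ord_max l))//= big1 ?addr0.
  rewrite !mxE eqxx (inj_eq lift_inj) [_ == ord_max]eq_sym (negPf (neq_lift _ _))
    mulr0 subr0 mulr1 eq_sym.
  by case: eqP => [->|_]; rewrite ?mulr0 ?mul0r// mulr1 mulfV.
by move=> j /negPf jl; rewrite !mxE jl !mulr0.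
Qed.

Lemma phase_H3 a : is_amplitude a -> cinematic_H3 phase a.
Proof.
move=> [_ _ _ sa] x xi /sa/phase_domain_smooth Uz; have [/= x2 xi0] := Uz.
rewrite curvature_matrix_phase//.
set W := (W in _^T *m W).
have Wf : row_free W.
  apply: curvature_sqrt_free => i;
    rewrite gt_eqF// sqrtr_gt0 mulr_gt0 ?gauss_map_last_gt0//.
  by rewrite divr_gt0// mulr_gt0// dil'_gt0//; lra.
have rW : \rank (W^T *m W) = k.
  by rewrite mxrankMfree// mxrank_tr; exact/eqP.
have [s sW sk] := gram_eigenvalues W.
by split => //; exists s => //; rewrite sk.
Qed.
End phase.

(** * The amplitude *)

Section amplitude.
Context {R : realType} (k : nat).
Local Notation Rn := 'rV[R]_k.+2.
Local Notation Rn1 := 'rV[R]_k.+1.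

(** With radius 1/n, a vector with n coordinates of size at most [rad] has squared norm at most n *
    rad^2 = rad <= 1/2, so the box fits in the unit ball. *)
Definition rad : R := k.+2%:R^-1.

(** The midpoint of the axis of the sector; as [rad <= 1/2], the box around it keeps the last
    coordinate between 1 and 2. *)
Definition freq0 : Rn1 := (3 / 2) *: delta_mx 0 ord_max.

Definition bump1 (s : R) : R := flat 1 (rad ^+ 2 - s ^+ 2).

Definition amplitude (z : Rn * Rn1) : R :=
  (\prod_(i < k.+2) bump1 (z.1 0 i)) * \prod_(j < k.+1) bump1 (z.2 0 j - freq0 0 j).

Lemma rad_gt0 : 0 < rad. Proof. by rewrite invr_gt0. Qed.

Lemma rad_le : rad <= 2^-1.
Proof. by rewrite lef_pV2 ?posrE// ler_nat. Qed.

Lemma bump1_ge0 s : 0 <= bump1 s. Proof. exact: flat1_ge0. Qed.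

Lemma bump1_le1 s : bump1 s <= 1. Proof. exact: flat1_le1. Qed.

Lemma bump1_neq0 s : bump1 s != 0 -> `|s| <= rad.
Proof.
move=> s0; have : 0 < bump1 s by rewrite lt0r s0 bump1_ge0.
rewrite flat1_gt0 subr_gt0 -real_normK ?num_real// => /ltW.
by rewrite ler_sqr ?nnegrE ?normr_ge0 ?(ltW rad_gt0).
Qed.

Lemma amplitude_ge0 z : 0 <= amplitude z.
Proof. by rewrite mulr_ge0// prodr_ge0// => *; exact: bump1_ge0. Qed.

Lemma amplitude_le1 z : amplitude z <= 1.
Proof.
by rewrite mulr_ile1 ?prodr_ge0 ?prodr_ile1// => *; rewrite bump1_ge0// bump1_le1.
Qed.

Definition bump_box : set (Rn * Rn1) :=
  [set x : Rn | forall i, `[- rad, rad]%classic (x ord0 i)] `*`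
  [set xi : Rn1 | forall j, `[freq0 0 j - rad, freq0 0 j + rad]%classic (xi ord0 j)].

Lemma amplitude_neq0 z : amplitude z != 0 -> bump_box z.
Proof.
rewrite mulf_eq0 negb_or => /andP[/prodf_neq0 h1 /prodf_neq0 h2]; split => [i|j] /=.
  by rewrite in_itv /=; have := bump1_neq0 (h1 i isT); rewrite ler_norml.
rewrite in_itv /=; have := bump1_neq0 (h2 j isT); rewrite ler_norml; lra.
Qed.

Lemma compact_bump_box : compact bump_box.
Proof.
apply: compact_setX.
  by apply: (@rV_compact R _ (fun=> `[- rad, rad]%classic)) => _;
    exact: segment_compact.
apply: (@rV_compact R _ (fun j => `[freq0 0 j - rad, freq0 0 j + rad]%classic)) => j.
exact: segment_compact.
Qed.

Lemma supp_amplitude : supp amplitude `<=` bump_box.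
Proof.
rewrite [X in _ `<=` X](closure_id _).1; last first.
  by apply: compact_closed; [exact: norm_hausdorff|exact: compact_bump_box].
by apply: closure_subset => z; exact: amplitude_neq0.
Qed.

Lemma enorm_le n (x : 'rV[R]_n) (b : R) : (forall i, `|x 0 i| <= b) ->
  enorm x ^+ 2 <= n%:R * b ^+ 2.
Proof.
move=> xb; rewrite sqr_sqrtr ?sumr_ge0// => [|i _]; last exact: sqr_ge0.
rewrite mulr_natl -[X in _ *+ X]card_ord -sumr_const ler_sum// => i _.
rewrite -real_normK ?num_real// ler_sqr ?nnegrE//.
exact: le_trans (xb i).
Qed.

Lemma bump_box_domain : bump_box `<=` phase_domain.
Proof.
move=> [x xi] [/= xB xiB]; have r0 := rad_gt0; have r2 := rad_le.
have rn : k.+2%:R * rad ^+ 2 = rad by rewrite expr2 mulrA mulfV ?mul1r.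
split => /=.
  have /enorm_le : forall i, `|(x - 0) 0 i| <= rad.
    by move=> i; rewrite subr0 ler_norml; have := xB i; rewrite /= in_itv.
  rewrite rn => x2; rewrite /eball /= -ltr_sqr ?nnegrE ?ler01 ?sqrtr_ge0// expr1n;
    lra.
have xil : 1 <= xi 0 ord_max <= 2.
  have := xiB ord_max; rewrite /= in_itv /= /freq0 !mxE !eqxx mulr1; lra.
split => //.
have /enorm_le : forall i, `|col' ord_max xi 0 i| <= rad.
  move=> i; rewrite mxE ler_norml; have := xiB (lift ord_max i).
  by rewrite /= in_itv /= /freq0 !mxE /= eq_sym (negPf (neq_lift _ _)) mulr0 sub0r
    add0r.
move=> c2; apply: (@le_trans _ _ 1); last by case/andP: xil.
rewrite -ler_sqr ?nnegrE ?ler01 ?sqrtr_ge0// expr1n; apply: (le_trans c2).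
apply: (@le_trans _ _ (k.+2%:R * rad ^+ 2)); last by rewrite rn; lra.
by rewrite ler_wpM2r ?sqr_ge0// ler_nat /= ltnW.
Qed.

Lemma amplitudeP : is_amplitude amplitude.
Proof.
split.
- exists setT; split => //; first exact: openT.
  apply: elementary_smooth; first exact: openT.
  have eb (f : Rn * Rn1 -> R) : elementary setT f -> elementary setT (fun z =>
    bump1 (f z)).
    move=> ef; apply: elementary_flat.
    under eq_fun do rewrite -mulN1r expr2.
    apply: elementaryD; first exact: elementary_cst.
    by apply: elementaryM; [exact: elementary_cst|exact: elementaryM].
  apply: elementaryM; apply: elementary_prod => i; apply: eb;
    first exact: elementary_fst.
  by apply: elementaryD; [exact: elementary_snd|exact: elementary_cst].
- apply: subclosed_compact compact_bump_box supp_amplitude.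
  exact: closed_closure.
- exact: amplitude_ge0.
- exact: subset_trans supp_amplitude bump_box_domain.
Qed.

(** For |s| <= rad/2 one has rad^2 - s^2 >= 3/4 rad^2, which exceeds rad^2/2; the exponent is the
    number of one-dimensional factors. *)
Definition amplitude_min : R := flat 1 (rad ^+ 2 / 2) ^+ (k.+2 + k.+1).

Lemma amplitude_min_gt0 : 0 < amplitude_min.
Proof. by rewrite exprn_gt0// flat1_gt0 divr_gt0// exprn_gt0// rad_gt0. Qed.

Lemma amplitude_ge_min (z : Rn * Rn1) : (forall i, `|z.1 0 i| <= rad / 2) ->
  (forall j, `|z.2 0 j - freq0 0 j| <= rad / 2) -> amplitude_min <= amplitude z.
Proof.
move=> h1 h2; have r0 := rad_gt0.
have hb (s : R) : `|s| <= rad / 2 -> flat 1 (rad ^+ 2 / 2) <= bump1 s.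
  move=> s2; apply: le_flat1; rewrite -(real_normK (num_real s)).
  have : `|s| ^+ 2 <= (rad / 2) ^+ 2 by rewrite ler_sqr ?nnegrE// divr_ge0 ?ltW.
  rewrite exprMn; have : 0 < rad ^+ 2 by rewrite exprn_gt0.
  lra.
rewrite /amplitude_min exprD; apply: ler_pM; rewrite ?exprn_ge0 ?flat1_ge0//.
  rewrite -[X in _ ^+ X]card_ord -prodr_const; apply: ler_prod => i _.
  by rewrite flat1_ge0 hb.
rewrite -[X in _ ^+ X]card_ord -prodr_const; apply: ler_prod => i _.
by rewrite flat1_ge0 hb.
Qed.
End amplitude.

(** * The oscillatory operator *)

Section measurability.
Context {R : realType}.

(** The inverse takes the value 0 at 0, where it is discontinuous; that point is split off. *)
Lemma measurable_inv : measurable_fun setT (fun x : R => x^-1).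
Proof.
have -> : setT = [set 0] `|` [set x : R | x != 0].
  by apply/seteqP; split => // x _; case: (eqVneq x 0); [left|right].
have o0 : open [set x : R | x != 0] by exact: open_neq.
apply/measurable_funU => //; first exact: open_measurable.
split; first exact: measurable_fun_set1.
apply: open_continuous_measurable_fun => // x; rewrite inE /= => x0.
exact: inv_continuous.
Qed.

Lemma measurable_param_Rintegral d1 d2 (T1 : measurableType d1) (T2 : measurableType
  d2)
    (mu : {sigma_finite_measure set T2 -> \bar R}) (K : T1 * T2 ->
      R) (S : set T2) (M : R) :
  measurable_fun setT K -> measurable S -> (mu S < +oo)%E ->
  (forall x y, `|K (x, y)| <= M * \1_S y) ->
  (forall x, mu.-integrable setT (fun y => (K (x, y))%:E)) /\
  measurable_fun setT (fun x => \int[mu]_y K (x, y)).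
Proof.
move=> mK mS muS KM.
have mKx x : measurable_fun setT (fun y => K (x, y)).
  by apply: (measurableT_comp mK); exact: measurable_fun_pair.
have iS : mu.-integrable setT (fun y => (M * \1_S y)%:E).
  under eq_fun do rewrite EFinM.
  apply: integrableZl => //; apply/integrableP; split.
    by apply/measurable_EFinP; exact: measurable_indic.
  under eq_integral do rewrite gee0_abs ?lee_fin//.
  by rewrite integral_indic// setIT.
have iK x : mu.-integrable setT (fun y => (K (x, y))%:E).
  apply: le_integrable iS => //; first exact/measurable_EFinP.
  move=> y _ /=; rewrite lee_fin; apply: (le_trans (KM x y)).
  exact: ler_norm.
split=> //.
(* [K] has no sign, so Tonelli's theorem is applied to [K + M * \1_S], which is nonnegative by the
   bound, and the finite constant [c] is subtracted afterwards. *)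
pose c := \int[mu]_y (M * \1_S y).
have -> : (fun x => \int[mu]_y K (x, y)) =
    (fun x => fine (\int[mu]_y (K (x, y) + M * \1_S y)%:E)%E - c).
  apply/funext => x; rewrite -[fine _]/(\int[mu]_y (K (x, y) + M * \1_S y)).
  by rewrite (RintegralD measurableT (iK x) iS) addrK.
apply: measurable_funB => //; apply: measurableT_comp => //.
apply: (@measurable_fun_fubini_tonelli_F _ _ _ _ _ mu (fun z =>
  (K z + M * \1_S z.2)%:E)).
- apply/measurable_EFinP; apply: measurable_funD => //.
  apply: measurable_funM => //; apply: (measurableT_comp _ measurable_snd).
  exact: measurable_indic.
- move=> [x y]; rewrite lee_fin; have := KM x y; rewrite ler_norml /=; lra.
Qed.

End measurability.
Section oscillatory.
Context {R : realType} (k : nat).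
Local Notation Rn := 'rV[R]_k.+2.
Local Notation Rn1 := 'rV[R]_k.+1.
Implicit Types (f g : Rn1 -> R[i]) (lambda M : R).

Definition frequency_box : set Rn1 :=
  tube (fun j _ => (freq0 k : Rn1) 0 j) (fun=> rad k).

Lemma measurable_frequency_box : measurable frequency_box.
Proof. by apply: measurable_tube => j; exact: measurable_cst. Qed.

Lemma measure_frequency_box : (lebesgue_rV k.+1 frequency_box <= 1)%E.
Proof.
rewrite measure_tube => //; last by move=> _; rewrite ltW// rad_gt0.
rewrite lee_fin prodr_ile1// => j _; have := @rad_gt0 R k; have := @rad_le R k; lra.
Qed.

Lemma measurable_rescaled_coord lambda i :
  measurable_fun setT (fun z : Rn * Rn1 => (lambda^-1 *: z.1) 0 i).
Proof.
under eq_fun do rewrite mxE; apply: measurable_funM => //.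
exact: (measurableT_comp (measurable_coord i) measurable_fst).
Qed.

Lemma measurable_coord2 j : measurable_fun setT (fun z : Rn * Rn1 => z.2 0 j).
Proof. exact: (measurableT_comp (measurable_coord j) measurable_snd). Qed.

Lemma measurable_rescaled_phase lambda :
  measurable_fun setT (rescaled_phase lambda (@phase R k)).
Proof.
rewrite /rescaled_phase /phase /cone /=; apply: measurable_funM => //.
apply: measurable_funD.
  apply: measurable_sum => j; apply: measurable_funM.
    exact: measurable_rescaled_coord.
  exact: measurable_coord2.
apply: measurable_funM; last first.
  exact: (measurableT_comp measurable_inv (measurable_coord2 _)).
apply: measurable_sum => i; apply: measurable_funM; last first.
  by apply: measurable_funX; exact: measurable_coord2.
have m2 : measurable_fun setT (fun z : Rn * Rn1 => 2 + (lambda^-1 *: z.1) 0 ord_max).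
  by apply: measurable_funD => //; exact: measurable_rescaled_coord.
rewrite /dil; case: (odd i) => //.
by apply: measurable_funN; exact: (measurableT_comp measurable_inv m2).
Qed.

Lemma measurable_rescaled_amplitude lambda :
  measurable_fun setT (rescaled_amplitude lambda (@amplitude R k)).
Proof.
have mb (h : Rn * Rn1 -> R) : measurable_fun setT h ->
    measurable_fun setT (fun z => bump1 k (h z)).
  move=> mh; apply: (measurableT_comp (continuous_measurable_fun (@flat_continuous R
    1))).
  by apply: measurable_funB => //; exact: measurable_funX.
rewrite /rescaled_amplitude /amplitude /=; apply: measurable_funM.
  by apply: measurable_prod => i _; apply: mb; exact: measurable_rescaled_coord.
apply: measurable_prod => j _; apply: mb; apply: measurable_funB => //.
exact: measurable_coord2.
Qed.

Lemma rescaled_amplitude_le lambda x xi :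
  `|rescaled_amplitude lambda (@amplitude R k) (x, xi)| <= \1_frequency_box xi.
Proof.
rewrite ger0_norm ?amplitude_ge0// /rescaled_amplitude.
set z := (_, _); have [->|/amplitude_neq0 [_ /= H]] := eqVneq (amplitude z) 0.
  by rewrite indicE.
rewrite indicE mem_set ?amplitude_le1// => j.
by have := H j; rewrite /= in_itv /= ler_norml; lra.
Qed.

Definition kernel_phase lambda (z : Rn * Rn1) : R :=
  - (2 * pi * rescaled_phase lambda (@phase R k) z).

Definition kernel (c : R -> R) lambda (z : Rn * Rn1) : R :=
  c (kernel_phase lambda z) * rescaled_amplitude lambda (@amplitude R k) z.

Lemma measurable_kernel c lambda : continuous c ->
  measurable_fun setT (kernel c lambda).
Proof.
move=> cc; apply: measurable_funM; last exact: measurable_rescaled_amplitude.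
apply: (measurableT_comp (continuous_measurable_fun cc)).
by apply: measurable_funN; apply: measurable_funM => //;
  exact: measurable_rescaled_phase.
Qed.

(** No decay is required: the amplitude already confines xi to [frequency_box], of finite measure,
    so bounded data have convergent integrals. *)
Definition tame M f := cmeasurable f /\
  forall xi, `|complex.Re (f xi)| <= M /\ `|complex.Im (f xi)| <= M.

Definition kernel_re lambda f (z : Rn * Rn1) : R :=
  kernel cos lambda z * complex.Re (f z.2) - kernel sin lambda z * complex.Im (f
    z.2).

Definition kernel_im lambda f (z : Rn * Rn1) : R :=
  kernel cos lambda z * complex.Im (f z.2) +
    kernel sin lambda z * complex.Re (f z.2).

Let T lambda f := oscillatory_op (@phase R k) (@amplitude R k) lambda f.

Lemma oscillatory_opE lambda f x :
  T lambda f x = Complex (\int[lebesgue_rV k.+1]_xi kernel_re lambda f (x, xi))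
    (\int[lebesgue_rV k.+1]_xi kernel_im lambda f (x, xi)).
Proof.
rewrite /T /oscillatory_op /cintegral; congr Complex; congr Rintegral;
  apply/funext => xi;
  rewrite /kernel_re /kernel_im /kernel /kernel_phase /=; case: (f xi) => u v /=;
    ring.
Qed.

Lemma tame_ge0 M f : tame M f -> 0 <= M.
Proof. by move=> [_ /(_ 0) [+ _]]; exact: le_trans. Qed.

Lemma kernel_parts lambda M f : tame M f ->
  [/\ measurable_fun setT (kernel_re lambda f),
    measurable_fun setT (kernel_im lambda f),
     forall x xi, `|kernel_re lambda f (x, xi)| <= (2 * M) * \1_frequency_box xi &
     forall x xi, `|kernel_im lambda f (x, xi)| <= (2 * M) * \1_frequency_box xi].
Proof.
move=> tf; have M0 := tame_ge0 tf; move: tf => [[mr mi] fM].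
have mr2 : measurable_fun setT (fun z : Rn * Rn1 => complex.Re (f z.2)).
  exact: (measurableT_comp mr measurable_snd).
have mi2 : measurable_fun setT (fun z : Rn * Rn1 => complex.Im (f z.2)).
  exact: (measurableT_comp mi measurable_snd).
have mc := measurable_kernel lambda (@continuous_cos R).
have ms := measurable_kernel lambda (@continuous_sin R).
have kc c x xi : (forall t, `|c t| <= 1) -> `|kernel c lambda (x,
  xi)| <= \1_frequency_box xi.
  move=> c1; rewrite normrM; apply: le_trans (rescaled_amplitude_le lambda x xi).
  by rewrite ler_piMl.
have bd a b u v (t : R) : `|a| <= t -> `|b| <= t -> `|u| <= M -> `|v| <= M ->
    `|a * u + b * v| <= 2 * M * t.
  move=> h1 h2 h3 h4; apply: (le_trans (ler_normD _ _)); rewrite !normrM.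
  have := ler_pM (normr_ge0 _) (normr_ge0 _) h1 h3.
  have := ler_pM (normr_ge0 _) (normr_ge0 _) h2 h4; lra.
split.
- by apply: measurable_funB; exact: measurable_funM.
- by apply: measurable_funD; exact: measurable_funM.
- move=> x xi; have [h1 h2] := fM xi; rewrite /kernel_re -mulrN; apply: bd => //.
  + by apply: kc => t; exact: cos_max.
  + by apply: kc => t; exact: sin_max.
  + by rewrite normrN.
- move=> x xi; have [h1 h2] := fM xi; apply: bd => //.
  + by apply: kc => t; exact: cos_max.
  + by apply: kc => t; exact: sin_max.
Qed.

Lemma kernel_integrable lambda M f x : tame M f ->
  (lebesgue_rV k.+1).-integrable setT (fun xi => (kernel_re lambda f (x, xi))%:E) /\
  (lebesgue_rV k.+1).-integrable setT (fun xi => (kernel_im lambda f (x, xi))%:E).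
Proof.
move=> /(kernel_parts lambda)[m1 m2 b1 b2].
have S1 := le_lt_trans measure_frequency_box (ltry 1).
split.
  exact: (measurable_param_Rintegral m1 measurable_frequency_box S1 b1).1.
exact: (measurable_param_Rintegral m2 measurable_frequency_box S1 b2).1.
Qed.

Lemma cmeasurable_oscillatory_op lambda M f : tame M f -> cmeasurable (T lambda f).
Proof.
move=> /(kernel_parts lambda)[m1 m2 b1 b2].
have S1 := le_lt_trans measure_frequency_box (ltry 1).
split; under eq_fun do rewrite oscillatory_opE /=.
  exact: (measurable_param_Rintegral m1 measurable_frequency_box S1 b1).2.
exact: (measurable_param_Rintegral m2 measurable_frequency_box S1 b2).2.
Qed.

Lemma oscillatory_opD lambda M M' f g x : tame M f -> tame M' g ->
  T lambda (fun xi => f xi + g xi) x = T lambda f x + T lambda g x.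
Proof.
move=> tf tg; rewrite !oscillatory_opE.
have [i1 i2] := kernel_integrable lambda x tf.
have [i3 i4] := kernel_integrable lambda x tg.
apply/eqP; rewrite eq_complex /=; apply/andP; split; apply/eqP.
  rewrite -RintegralD//; congr Rintegral; apply/funext => xi.
  rewrite /kernel_re /=; case: (f xi) (g xi) => a b [c d] /=; ring.
rewrite -RintegralD//; congr Rintegral; apply/funext => xi.
rewrite /kernel_im /=; case: (f xi) (g xi) => a b [c d] /=; ring.
Qed.

Lemma oscillatory_opN lambda M f x : tame M f ->
  T lambda (fun xi => - f xi) x = - T lambda f x.
Proof.
move=> tf; rewrite !oscillatory_opE.
have [i1 i2] := kernel_integrable lambda x tf.
apply/eqP; rewrite eq_complex /=; apply/andP; split; apply/eqP.
  rewrite -mulN1r -RintegralZl//; congr Rintegral; apply/funext => xi.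
  rewrite /kernel_re /=; case: (f xi) => a b /=; ring.
rewrite -mulN1r -RintegralZl//; congr Rintegral; apply/funext => xi.
rewrite /kernel_im /=; case: (f xi) => a b /=; ring.
Qed.

(** Each part of the integrand is at most [2 * M] on a box of measure at most 1. The bound is
    uniform in lambda, which allows powers above the threshold to be compared when the exponent is
    below 2. *)
Lemma oscillatory_op_bound lambda M f x : tame M f ->
  `|complex.Re (T lambda f x)| <= 2 * M /\ `|complex.Im (T lambda f x)| <= 2 * M.
Proof.
move=> tf; have M0 := tame_ge0 tf; rewrite !oscillatory_opE /=.
have [i1 i2] := kernel_integrable lambda x tf.
have [m1 m2 b1 b2] := kernel_parts lambda tf.
have mS := measurable_frequency_box.
have iS : (lebesgue_rV k.+1).-integrable setT (fun y =>
  ((2 * M) * \1_frequency_box y)%:E).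
  under eq_fun do rewrite EFinM.
  apply: integrableZl => //; apply/integrableP; split.
    by apply/measurable_EFinP; exact: measurable_indic.
  under eq_integral do rewrite gee0_abs ?lee_fin//.
  rewrite integral_indic// setIT.
  exact: le_lt_trans measure_frequency_box (ltry 1).
have bI : \int[lebesgue_rV k.+1]_xi ((2 * M) * \1_frequency_box xi) <= 2 * M.
  rewrite /Rintegral; under eq_integral do rewrite EFinM.
  rewrite ge0_integralZl_EFin//; last 2 first.
  - by apply/measurable_EFinP; exact: measurable_indic.
  - by rewrite mulr_ge0.
  rewrite integral_indic// setIT fineM//; last first.
    by rewrite ge0_fin_numE//; exact: le_lt_trans measure_frequency_box (ltry 1).
  rewrite [leLHS]/= ler_piMr ?mulr_ge0// -lee_fin fineK;
    first exact: measure_frequency_box.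
  by rewrite ge0_fin_numE//; exact: le_lt_trans measure_frequency_box (ltry 1).
have H (h : Rn1 -> R) : (lebesgue_rV k.+1).-integrable setT (EFin \o h) ->
   (forall xi, `|h xi| <= (2 * M) * \1_frequency_box xi) ->
   `|\int[lebesgue_rV k.+1]_xi h xi| <= 2 * M.
  move=> ih hM; apply: (le_trans (le_normr_Rintegral measurableT ih)).
  apply: le_trans bI; apply: le_Rintegral => //.
  exact: integrable_abse ih.
by split; apply: H.
Qed.

End oscillatory.

(** * Energy on a set and the choice of signs *)

Section energy.
Context {R : realType} (k : nat).
Local Notation Rn := 'rV[R]_k.+2.
Local Notation Rn1 := 'rV[R]_k.+1.

Definition sqmod (z : R[i]) : R := complex.Re z ^+ 2 + complex.Im z ^+ 2.

Lemma sqmod_ge0 z : 0 <= sqmod z. Proof. by rewrite addr_ge0 ?sqr_ge0. Qed.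

Definition energy (Y : set Rn) (F : Rn -> R[i]) : \bar R :=
  (\int[lebesgue_rV k.+2]_(x in Y) (sqmod (F x))%:E)%E.

Lemma measurable_sqmod (Y : set Rn) (F : Rn -> R[i]) :
  cmeasurable F -> measurable_fun Y (fun x => sqmod (F x)).
Proof.
move=> [mr mi]; apply: measurable_funTS.
by apply: measurable_funD; exact: measurable_funX.
Qed.

Lemma cmeasurableD n (F G : 'rV[R]_n -> R[i]) : cmeasurable F -> cmeasurable G ->
  cmeasurable (fun x => F x + G x).
Proof.
move=> [mr mi] [mr' mi']; split.
  under eq_fun do rewrite raddfD; exact: measurable_funD.
under eq_fun do rewrite raddfD; exact: measurable_funD.
Qed.

Lemma cmeasurableN n (F : 'rV[R]_n -> R[i]) : cmeasurable F ->
  cmeasurable (fun x => - F x).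
Proof.
move=> [mr mi]; split.
  under eq_fun do rewrite raddfN; exact: measurable_funN.
under eq_fun do rewrite raddfN; exact: measurable_funN.
Qed.

(** All terms are integrals of nonnegative functions, so the identity holds in the extended reals
    without any finiteness. *)
Lemma energy_parallelogram (Y : set Rn) (F G : Rn -> R[i]) : measurable Y ->
  cmeasurable F -> cmeasurable G ->
  (energy Y (fun x => F x + G x)%R + energy Y (fun x => F x - G x)%R =
   energy Y F + energy Y G + (energy Y F + energy Y G))%E.
Proof.
move=> mY mF mG.
have mS H : cmeasurable H -> measurable_fun Y (fun x => (sqmod (H x))%:E).
  by move=> mH; apply/measurable_EFinP; exact: measurable_sqmod.
have S0 (H : Rn -> R[i]) x : Y x -> (0 <= (sqmod (H x))%:E)%E.
  by move=> _; rewrite lee_fin sqmod_ge0.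
rewrite /energy -!ge0_integralD//.
- apply: eq_integral => x _; rewrite -!EFinD; congr (_%:E); rewrite /sqmod.
  by case: (F x) (G x) => a b [c d] /=; ring.
- by move=> x Yx; rewrite adde_ge0 ?S0.
- by apply: emeasurable_funD; exact: mS.
- by move=> x Yx; rewrite adde_ge0 ?S0.
- by apply: emeasurable_funD; exact: mS.
- exact: S0.
- exact: mS.
- exact: S0.
- exact: mS.
- exact: (S0 (fun x => F x + G x)).
- by apply: mS; exact: cmeasurableD.
- exact: (S0 (fun x => F x - G x)).
- by apply: mS; apply: cmeasurableD => //; exact: cmeasurableN.
Qed.

Lemma tameD M M' (f g : Rn1 -> R[i]) : tame M f -> tame M' g ->
  tame (M + M') (fun xi => f xi + g xi).
Proof.
move=> [mf fM] [mg gM]; split; first exact: cmeasurableD.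
move=> xi; have [h1 h2] := fM xi; have [h3 h4] := gM xi.
by rewrite !raddfD /=; split; apply: (le_trans (ler_normD _ _)); exact: lerD.
Qed.

Lemma tameN M (f : Rn1 -> R[i]) : tame M f -> tame M (fun xi => - f xi).
Proof.
move=> [mf fM]; split; first exact: cmeasurableN.
by move=> xi; rewrite !raddfN /= !normrN.
Qed.

Let T lambda f := oscillatory_op (@phase R k) (@amplitude R k) lambda f.

Definition signed (s : bool) (z : R[i]) := if s then z else - z.

(** A deterministic form of averaging over random signs: of the two signs of a new packet, one gives
    at least the mean of the two energies, which is the sum of the old energy and that of the
    packet. No orthogonality between packets is needed. *)
Lemma sign_choice (I : eqType) (r : seq I) (g : I -> Rn1 -> R[i]) M Y lambda :
  measurable Y -> uniq r -> (forall i, tame M (g i)) ->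
  exists s : I -> bool,
    tame (M *+ size r) (fun xi => \sum_(i <- r) signed (s i) (g i xi)) /\
    (\sum_(i <- r) energy Y (T lambda (g i)) <=
     energy Y (T lambda (fun xi => \sum_(i <- r) signed (s i) (g i xi))%R))%E.
Proof.
move=> mY + tg; elim: r => [_|i r IH /= /andP[ir ur]].
  exists xpredT; rewrite big_nil; split; last by apply: integral_ge0 => x _;
    rewrite lee_fin sqmod_ge0.
  have -> : (fun xi : Rn1 => \sum_(i <- [::]) signed true (g i xi)) = fun=> 0.
    by apply/funext => xi; rewrite big_nil.
  by split; [split; exact: measurable_cst|move=> xi /=; rewrite normr0].
have [s [tS sS]] := IH ur; pose S xi := \sum_(i <- r) signed (s i) (g i xi).
pose s' b j := if j == i then b else s j.
(* As [i] does not occur in [r], changing the sign at [i] leaves the earlier signs intact. *)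
have s'E b : (fun xi => \sum_(j <- i :: r) signed (s' b j) (g j xi)) =
    (fun xi => S xi + signed b (g i xi)).
  apply/funext => xi; rewrite big_cons addrC; congr (_ + _).
    apply: eq_big_seq => j jr; rewrite /s'.
    by case: eqP => // ji; rewrite -ji jr in ir.
  by rewrite /s' eqxx.
have tgi b : tame M (fun xi => signed b (g i xi)).
  by case: b; [exact: tg|exact: (tameN (tg i))].
have TE b : T lambda (fun xi => S xi + signed b (g i xi)) =
    (fun x => T lambda S x + signed b (T lambda (g i) x)).
  apply/funext => x; rewrite [LHS](oscillatory_opD lambda x tS (tgi b));
    congr (_ + _).
  by case: b => //; rewrite /= [LHS](oscillatory_opN lambda x (tg i)).
have mT := cmeasurable_oscillatory_op lambda tS.
have mTi := cmeasurable_oscillatory_op lambda (tg i).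
have P := energy_parallelogram mY mT mTi.
(* If both signs failed, adding the two strict inequalities would contradict the parallelogram
   law. *)
have [b Hb] : exists b, (energy Y (T lambda S) + energy Y (T lambda (g i)) <=
    energy Y (T lambda (fun xi => S xi + signed b (g i xi))%R))%E.
  apply: contrapT => /forallNP H.
  have := H true; have := H false; rewrite !TE => /negP; rewrite -ltNge => h1.
  move=> /negP; rewrite -ltNge => h2.
  by have := lteD h2 h1; rewrite P ltxx.
exists (s' b); rewrite s'E; split.
  by rewrite mulrSr; exact: tameD.
rewrite big_cons addeC; apply: le_trans Hb.
by rewrite leeD2r.
Qed.
End energy.

(** * Wave packets *)

Section packets.
Context {R : realType} (k N : nat).
Local Notation Rn := 'rV[R]_k.+2.
Local Notation Rn1 := 'rV[R]_k.+1.
Local Notation index := {ffun 'I_k.+1 -> 'I_N}.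

(** The index of the i-th coordinate of x'': its value is [i], and the two lifts skip the last two
    coordinates of x. *)
Definition xlast (i : 'I_k) : 'I_k.+2 := lift ord_max (lift ord_max i).

(** Expansion of the modulated phase about the ray of slope [u], with xi' = eta u + w. If [u] is the
    slope at a node, [D] and the bracket with x_(n-1) are the derivatives there in xi' and eta; the
    tube is where both are small. *)
Lemma phase_expand (x : Rn) (xi : Rn1) (u b : 'I_k -> R) : xi 0 ord_max != 0 ->
  let d i := dil i (x 0 ord_max) in
  let w i := xi 0 (lift ord_max i) - xi 0 ord_max * u i in
  let D i := x 0 (xlast i) + 2 * (d i * u i + b i) in
  phase (x, xi) + \sum_(i < k) 2 * b i * xi 0 (lift ord_max i) =
  xi 0 ord_max * (\sum_(i < k) D i * u i +
                  (x 0 (lift ord_max ord_max) - \sum_(i < k) d i * u i ^+ 2))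
  + (\sum_(i < k) w i * D i + \sum_(i < k) d i * w i ^+ 2 / xi 0 ord_max).
Proof.
move=> xi0 d w D.
rewrite /phase /= (bigD1_ord ord_max)//= /cone mulr_suml -!addrA -!big_split /=.
rewrite !mulrDr mulrN !mulr_sumr -!addrA [RHS]addrCA; congr (_ + _).
  by rewrite mulrC.
rewrite -sumrN -!big_split /=; apply: eq_bigr => i _.
by rewrite /D /w -/(d i) /xlast; field.
Qed.



Lemma dil_bound i (t : R) : `|t| <= 1 -> `|dil i t| <= 3.
Proof.
rewrite ler_norml => t1; rewrite /dil; case: ifP => _; last by rewrite ler_norml;
  lra.
rewrite normrN normfV (@le_trans _ _ 1)//; last by lra.
by rewrite invf_le1 ?normr_gt0; rewrite ?ler_normr ?gt_eqF//; lra.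
Qed.

Lemma ler_sum_bound (F : 'I_k -> R) b : (forall i, `|F i| <= b) ->
  `|\sum_(i < k) F i| <= k%:R * b.
Proof.
move=> Fb; apply: (le_trans (ler_norm_sum _ _ _)).
by rewrite mulr_natl -[X in _ *+ X]card_ord -sumr_const ler_sum.
Qed.

(** No first-order term survives: the difference is (eta - eta0) E + sum w D + sum d w^2 / eta, and
    every summand is a product of two factors of order [e]. The contributions e^2, k e^2 and 3 k e^2
    add up to less than the stated bound; [k * c <= 1] prevents [E] from growing with k. *)
Lemma phase_variation (x : Rn) (xi xi0 : Rn1) (u b : 'I_k -> R) (c e : R) :
  let d i := dil i (x 0 ord_max) in
  let F xi := phase (x, xi) + \sum_(i < k) 2 * b i * xi 0 (lift ord_max i) in
  `|x 0 ord_max| <= 1 -> 1 <= xi 0 ord_max -> 1 <= xi0 0 ord_max ->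
  (forall i, xi0 0 (lift ord_max i) = xi0 0 ord_max * u i) ->
  0 <= c <= 1 -> k%:R * c <= 1 -> (forall i, `|u i| <= c) ->
  (forall j, `|xi 0 j - xi0 0 j| <= e / 2) ->
  (forall i, `|x 0 (xlast i) + 2 * (d i * u i + b i)| <= e) ->
  `|x 0 (lift ord_max ord_max) - \sum_(i < k) d i * u i ^+ 2| <= e ->
  `|F xi - F xi0| <= 4 * k.+1%:R * e ^+ 2.
Proof.
move=> d F x1 eta1 eta01 xi0E /andP[c0 c1] kc uc xiB DB zB.
have n0 : xi 0 ord_max != 0 by apply/eqP; lra.
have n00 : xi0 0 ord_max != 0 by apply/eqP; lra.
have e0 : 0 <= e by apply: le_trans zB.
have k0 : 0 <= k%:R :> R by [].
rewrite /F (phase_expand x u b n0) (phase_expand x u b n00) -/d.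
pose D i := x 0 (xlast i) + 2 * (d i * u i + b i).
have {}DB i : `|D i| <= e by exact: DB.
set z := x 0 _ - _.
have w0 i : xi0 0 (lift ord_max i) - xi0 0 ord_max * u i = 0 by rewrite xi0E subrr.
rewrite [X in _ - (_ + (X + _))]big1 => [|i _]; last by rewrite w0 mul0r.
rewrite [X in _ - (_ + (_ + X))]big1 => [|i _];
  last by rewrite w0 expr0n/= mulr0 mul0r.
rewrite !addr0 -/z addrAC -mulrBl.
pose E := \sum_(i < k) D i * u i + z.
have EB : `|E| <= 2 * e.
  have : `|\sum_(i < k) D i * u i| <= k%:R * (e * c).
    by apply: ler_sum_bound => i; rewrite normrM ler_pM.
  have : k%:R * (e * c) <= e by rewrite mulrCA ler_piMr.
  have := ler_normD (\sum_(i < k) D i * u i) z; rewrite -/E.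
  move: zB; lra.
pose w i := xi 0 (lift ord_max i) - xi 0 ord_max * u i.
have wB i : `|w i| <= e.
  have -> : w i = (xi 0 (lift ord_max i) - xi0 0 (lift ord_max i)) - (xi 0 ord_max -
    xi0 0 ord_max) * u i.
    by rewrite /w xi0E; ring.
  apply: (le_trans (ler_normB _ _)); rewrite normrM.
  have := xiB (lift ord_max i);
    have := ler_pM (normr_ge0 _) (normr_ge0 _) (xiB ord_max) (uc i).
  have : e / 2 * c <= e / 2 by rewrite ler_piMr// divr_ge0.
  lra.
have B1 : `|\sum_(i < k) w i * D i| <= k%:R * (e * e).
  by apply: ler_sum_bound => i; rewrite normrM ler_pM.
have B2 : `|\sum_(i < k) d i * w i ^+ 2 / xi 0 ord_max| <= k%:R * (3 * (e * e)).
  apply: ler_sum_bound => i; rewrite normrM normfV ler_pdivrMr ?normr_gt0//.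
  rewrite (ger0_norm (le_trans ler01 eta1)) normrM normrX expr2.
  apply: (@le_trans _ _ (3 * (e * e))); last by rewrite ler_peMr// !mulr_ge0.
  by rewrite ler_pM ?dil_bound ?mulr_ge0// ler_pM.
have B3 : `|(xi 0 ord_max - xi0 0 ord_max) * E| <= e / 2 * (2 * e).
  by rewrite normrM ler_pM.
rewrite -[X in X * _ + _]/(xi 0 ord_max - xi0 0 ord_max) -[X in _ * X + _]/E.
rewrite -[X in _ + (X + _)]/(\sum_(i < k) w i * D i).
rewrite -[X in _ + (_ + X)]/(\sum_(i < k) d i * w i ^+ 2 / xi 0 ord_max).
apply: (le_trans (ler_normD _ _)).
have := ler_normD (\sum_(i < k) w i * D i) (\sum_(i <
  k) d i * w i ^+ 2 / xi 0 ord_max).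
have ee : 0 <= e * e by rewrite mulr_ge0.
rewrite -natr1 expr2; move: B1 B2 B3; lra.
Qed.
End packets.

Section tubes.
Context {R : realType} (k N : nat).
Local Notation Rn := 'rV[R]_k.+2.
Local Notation Rn1 := 'rV[R]_k.+1.
Local Notation grid := {ffun 'I_k.+1 -> 'I_N}.
Local Notation n := (k.+2%:R : R).

(** The factor 1/100 leaves room both for a phase variation below 1/2 and for tubes inside the
    region where the amplitude is bounded below. *)
Definition small : R := rad k / 100.

Definition scale : R := N%:R ^+ 2.

Definition mesh : R := small / N%:R.

Definition node (m : grid) : Rn1 := \row_j (freq0 k 0 j + mesh * (m j)%:R).

(** The half-side is a quarter of the spacing, so distinct cubes are separated by gaps. *)
Definition cube (m : grid) : set Rn1 := tube (fun j _ =>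
  node m 0 j) (fun=> mesh / 4).

(** Extended by 0 to all indices: for odd k the last index has no partner, and the default makes the
    corresponding row of [B] zero. *)
Definition node_slope (m : grid) (i : nat) : R :=
  if insub i is Some i' then slope (node m) (i' : 'I_k) else 0.

(* [shear m] is [B u], where [u] is the slope of the node and [B] is the
   antisymmetric matrix made of 2 x 2 blocks [[0, 1], [-1, 0]]. *)
Definition shear (m : grid) (i : nat) : R :=
  if odd i then - node_slope m i.-1 else node_slope m i.+1.

Definition packet (m : grid) (xi : Rn1) : R[i] :=
  (\1_(cube m) xi)%:C%C *
  expi (- (2 * pi * (scale * \sum_(i < k) 2 * shear m i * xi 0 (lift ord_max i)))).

(** The axis consists of the points where the xi-gradient of the modulated phase vanishes at the
    node. The outer [None] is x_n, along which the tube is long, and the inner one is x_(n-1). *)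
Definition tube_center (m : grid) (i : 'I_k.+2) (x : Rn) : R :=
  let t := scale^-1 * x 0 ord_max in
  if unlift ord_max i is Some j then
    if unlift ord_max j is Some i' then
      - scale * (2 * (dil i' t * slope (node m) i' + shear m i'))
    else scale * \sum_(l < k) dil l t * slope (node m) l ^+ 2
  else 0.

Definition tube_width (i : 'I_k.+2) : R :=
  if i == ord_max then small * scale else small * N%:R.

Definition packet_tube (m : grid) : set Rn := tube (tube_center m) tube_width.

Hypothesis N0 : (0 < N)%N.

Lemma NR_ge1 : 1 <= N%:R :> R. Proof. by rewrite ler1n. Qed.

Lemma small_gt0 : 0 < small. Proof. by rewrite divr_gt0// rad_gt0. Qed.

Lemma small_le1 : small <= 200^-1.
Proof. by have := @rad_le R k; rewrite /small; lra. Qed.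

Lemma k_small : k.+2%:R * small = 100^-1.
Proof. by rewrite /small /rad mulrA mulfV// mul1r. Qed.

Lemma k_small_le1 : k%:R * small <= 100^-1.
Proof. by rewrite -k_small ler_wpM2r ?(ltW small_gt0)// ler_nat ltnW. Qed.

Lemma scale_ge1 : 1 <= scale. Proof. by rewrite expr_ge1 ?NR_ge1// ler0n. Qed.

Lemma scale_gt0 : 0 < scale. Proof. exact: lt_le_trans scale_ge1. Qed.

Lemma scale_mesh : scale * mesh = small * N%:R.
Proof. by rewrite /scale /mesh; have := NR_ge1 => ?; field; lra. Qed.

Lemma scale_mesh2 : scale * mesh ^+ 2 = small ^+ 2.
Proof. by rewrite /scale /mesh; have := NR_ge1 => ?; field; lra. Qed.

Lemma mesh_gt0 : 0 < mesh.
Proof. by rewrite divr_gt0 ?small_gt0// (lt_le_trans ltr01 NR_ge1). Qed.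

Lemma mesh_le : mesh <= small.
Proof.
rewrite ler_pdivrMr ?(lt_le_trans ltr01 NR_ge1)//.
by rewrite ler_peMr ?NR_ge1// ltW// small_gt0.
Qed.

Lemma nodeB m j : 0 <= node m 0 j - freq0 k 0 j <= small.
Proof.
rewrite mxE [_ + _ - _]addrAC subrr add0r mulr_ge0 ?(ltW mesh_gt0)//=.
rewrite /mesh mulrAC ler_pdivrMr ?(lt_le_trans ltr01 NR_ge1)//.
by rewrite ler_pM2l ?small_gt0// ler_nat ltnW.
Qed.

Lemma freq0_last : freq0 k 0 ord_max = 3 / 2 :> R.
Proof. by rewrite !mxE !eqxx mulr1. Qed.

Lemma freq0_lift i : freq0 k 0 (lift ord_max i) = 0 :> R.
Proof. by rewrite !mxE /= eq_sym (negPf (neq_lift _ _)) mulr0. Qed.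

Lemma node_last m : 3 / 2 <= node m 0 ord_max.
Proof. by have := nodeB m ord_max; rewrite freq0_last; lra. Qed.

Lemma slope_nodeE m i : node m 0 (lift ord_max i) =
  node m 0 ord_max * slope (node m) i.
Proof. by rewrite /slope; have := node_last m => ?; field; lra. Qed.

Lemma slope_nodeB m i : `|slope (node m) i| <= small.
Proof.
have h := nodeB m (lift ord_max i); rewrite freq0_lift subr0 in h.
have h' := node_last m; rewrite /slope normrM normfV.
rewrite ler_pdivrMr ?normr_gt0; last by lra.
rewrite ger0_norm; last by lra.
rewrite ger0_norm; last by lra.
have s0 := small_gt0; have : small * 1 <=
  small * node m 0 ord_max by rewrite ler_pM2l//; lra.
lra.
Qed.

Lemma node_slopeE m (i : 'I_k) : node_slope m i = slope (node m) i.
Proof. by rewrite /node_slope insubT//= => lt; congr slope; apply/val_inj. Qed.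

Lemma node_slopeB m i : `|node_slope m i| <= small.
Proof.
rewrite /node_slope; case: insubP => [i' _ _|_]; first exact: slope_nodeB.
by rewrite normr0 ltW// small_gt0.
Qed.

Lemma shearB m i : `|shear m i| <= small.
Proof. by rewrite /shear; case: ifP => _; rewrite ?normrN node_slopeB. Qed.

(** After division by [scale] the transverse width [small * N] becomes [mesh], the same size as the
    frequency cubes. *)
Lemma tubeP m x : packet_tube m x -> let X := scale^-1 *: x in
  [/\ `|X 0 ord_max| <= small,
     forall i : 'I_k, `|X 0 (xlast i) + 2 * (dil i (X 0 ord_max) * slope (node m) i +
       shear m i)| <= mesh &
     `|X 0 (lift ord_max ord_max) - \sum_(i <
       k) dil i (X 0 ord_max) * slope (node m) i ^+ 2| <= mesh].
Proof.
move=> H X; have s0 := scale_gt0.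
have sV (y : R) : `|y| <= small * N%:R -> `|scale^-1 * y| <= mesh.
  move=> yb; rewrite normrM normfV (gtr0_norm s0) mulrC ler_pdivrMr// mulrC
    scale_mesh//.
have XE i : X 0 i = scale^-1 * x 0 i by rewrite mxE.
split.
- have := H ord_max; rewrite /tube_center /tube_width unlift_none eqxx subr0 XE.
  by rewrite normrM normfV (gtr0_norm s0) ler_pdivrMl// [scale * _]mulrC.
- move=> i; have := H (xlast i); rewrite /tube_center /tube_width /xlast !liftK.
  rewrite eq_sym (negPf (neq_lift _ _)) => /sV; rewrite -XE mulNr opprK mulrDr -XE.
  by rewrite mulKf// gt_eqF.
- have := H (lift ord_max ord_max);
  rewrite /tube_center /tube_width liftK unlift_none.
  rewrite eq_sym (negPf (neq_lift _ _)) => /sV; rewrite -XE mulrBr -XE.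
  by rewrite mulKf// gt_eqF.
Qed.
End tubes.

(** * Lower bound for one packet on its tube *)

Section packet_bound.
Context {R : realType} (k N : nat).
Local Notation Rn := 'rV[R]_k.+2.
Local Notation Rn1 := 'rV[R]_k.+1.
Local Notation grid := {ffun 'I_k.+1 -> 'I_N}.
Hypothesis N0 : (0 < N)%N.
Local Notation scale := (@scale R N).
Local Notation small := (@small R k).
Local Notation mesh := (@mesh R k N).

Lemma cos_ge_half (t : R) : `|t| <= 2^-1 -> 2^-1 <= cos t.
Proof.
move=> t2; rewrite -cos_norm; set s := `|t|.
have [c] := @MVT_segment R cos (fun x => - sin x) 0 s (normr_ge0 t)
  (fun x _ => is_derive_cos x) (continuous_subspaceT (@continuous_cos R)).
move=> _; rewrite cos0 subr0 => E.
have := sin_le1 c; have s0 : 0 <= s := normr_ge0 t.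
have : - sin c * s >= - s; last by rewrite -E -/s in t2 *; lra.
by rewrite mulNr lerN2 ler_piMl ?sin_le1.
Qed.

Lemma cubeP (m : grid) (xi : Rn1) : cube m xi ->
  [/\ forall j, `|xi 0 j - node m 0 j| <= mesh / 2,
     forall j, `|xi 0 j - freq0 k 0 j| <= rad k / 2 & 1 <= xi 0 ord_max].
Proof.
move=> H; have s0 := @mesh_gt0 R k N N0; have s1 := @mesh_le R k N N0.
have c1 := @small_le1 R k; have c0 := @small_gt0 R k.
have rE : rad k = 100 * small by rewrite /small; field.
split.
- by move=> j; apply: (le_trans (H j)); lra.
- move=> j; have := H j; have := @nodeB R k N N0 m j; rewrite !ler_norml; lra.
- have := H ord_max; have := @node_last R k N N0 m; rewrite ler_norml; lra.
Qed.

Lemma measurable_cube (m : grid) : measurable (cube m : set Rn1).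
Proof. by apply: measurable_tube => j; exact: measurable_cst. Qed.

Lemma measure_cube (m : grid) :
  lebesgue_rV k.+1 (cube m) = ((mesh / 2) ^+ k.+1)%:E.
Proof.
rewrite measure_tube //; last by move=> _; have := @mesh_gt0 R k N N0; lra.
by rewrite prodr_const card_ord; congr (_ ^+ _)%:E; field.
Qed.

Definition packet_phase (m : grid) (xi : Rn1) : R :=
  - (2 * pi * (scale * \sum_(i < k) 2 * shear m i * xi 0 (lift ord_max i))).

Lemma packetE (m : grid) (xi : Rn1) : packet m xi =
  Complex (\1_(cube m) xi * cos (packet_phase m xi)) (\1_(cube m) xi * sin
    (packet_phase m xi)).
Proof.
rewrite /packet /expi -/(packet_phase m xi).
by apply/eqP; rewrite eq_complex /= !mul0r subr0 addr0 !eqxx.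
Qed.

Lemma tame_packet (m : grid) : tame 1 (packet m : Rn1 -> R[i]).
Proof.
have mI : measurable_fun setT (\1_(cube m) : Rn1 -> R).
  by apply: measurable_indic; exact: measurable_cube.
have mp : measurable_fun setT (packet_phase m).
  apply: measurable_funN; apply: measurable_funM => //; apply: measurable_funM => //.
  apply: measurable_sum => i; apply: measurable_funM => //; exact: measurable_coord.
split.
  split; under eq_fun do rewrite packetE /=; apply: measurable_funM => //.
    exact: (measurableT_comp (continuous_measurable_fun (@continuous_cos R))).
  exact: (measurableT_comp (continuous_measurable_fun (@continuous_sin R))).
move=> xi; rewrite packetE /= !normrM.
have I1 : `|\1_(cube m) xi : R| <= 1.
  by rewrite indicE; case: (_ \in _); rewrite ?normr1 ?normr0.
by split; apply: mulr_ile1 => //; [exact: cos_max|exact: sin_max].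
Qed.

Let F (m : grid) (X : Rn) (xi : Rn1) :=
  phase (X, xi) + \sum_(i < k) 2 * shear m i * xi 0 (lift ord_max i).

(** Since [scale * mesh ^+ 2 = small ^+ 2], the second-order error is independent of N; this
    dictates cubes of side lambda^(-1/2). Numerically it is at most 4/100/200, and 2 pi <= 8. *)
Lemma packet_phase_variation (m : grid) (x : Rn) (xi : Rn1) :
  packet_tube m x -> cube m xi ->
  `|2 * pi * (scale * (F m (scale^-1 *: x) xi - F m (scale^-1 *: x) (node m)))| <=
    2^-1.
Proof.
move=> /(tubeP N0)[h1 h2 h3] /cubeP[h4 _ h5].
have c1 := @small_le1 R k; have c0 := @small_gt0 R k.
have kc := @k_small_le1 R k.
have n0 : 1 <= (node m : Rn1) 0 ord_max by have := @node_last R k N N0 m; lra.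
have V : `|F m (scale^-1 *: x) xi - F m (scale^-1 *: x) (node m)| <=
  4 * k.+1%:R * mesh ^+ 2.
  have h1' : `|(scale^-1 *: x) 0 ord_max| <= 1 by lra.
  have cc : 0 <= small <= 1 by lra.
  have kc1 : k%:R * small <= 1 by lra.
  exact: (@phase_variation R k (scale^-1 *: x) xi (node m) (slope (node m)) (shear m)
    small mesh h1' h5 n0 (slope_nodeE N0 m) cc kc1 (slope_nodeB N0 m) h4 h2 h3).
rewrite normrM (gtr0_norm (_ : 0 < 2 * pi)) ?mulr_gt0 ?pi_gt0//.
rewrite normrM (gtr0_norm (@scale_gt0 R N N0)).
have : scale * `|F m (scale^-1 *: x) xi - F m (scale^-1 *: x) (node m)| <=
    4 * (k.+1%:R * small) * small.
  apply: (le_trans (ler_wpM2l (ltW (@scale_gt0 R N N0)) V)).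
  by rewrite mulrCA scale_mesh2// expr2 !mulrA.
set y := scale * _ => yB.
have y0 : 0 <= y by rewrite mulr_ge0// ltW// scale_gt0.
have k1 : k.+1%:R * small <=
  100^-1 by rewrite -(@k_small R k) ler_wpM2r ?ler_nat// ltW.
have yB2 : y <= 4 * 100^-1 * 200^-1.
  have : k.+1%:R * small * small <= 100^-1 * 200^-1 :> R.
    exact: (ler_pM (mulr_ge0 (ler0n _ _) (ltW c0)) (ltW c0) k1 c1).
  lra.
have pi4 : 2 * pi <= 8 :> R by have := pihalf_lt2 R; lra.
have : 2 * pi * y <= 8 * (4 * 100^-1 * 200^-1) by rewrite ler_pM// mulr_ge0// pi_ge0.
lra.
Qed.

(** The coordinates of x'' are at most mesh + 2 (3 small + small) <= 9 small, and the other two are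
    smaller still, whereas [rad / 2] is 50 small. *)
Lemma packet_tube_small (m : grid) (x : Rn) : packet_tube m x ->
  forall i, `|(scale^-1 *: x) 0 i| <= rad k / 2.
Proof.
move=> /(tubeP N0); set X := scale^-1 *: x; move=> [h1 h2 h3].
have c1 := @small_le1 R k; have c0 := @small_gt0 R k.
have kc := @k_small_le1 R k; have ms := @mesh_le R k N N0.
have rE : rad k = 100 * small by rewrite /small; field.
have d3 j : `|dil j (X 0 ord_max)| <= 3 by apply: dil_bound; lra.
have uB j : `|slope (node m) j| <= small := slope_nodeB N0 m j.
move=> i; case: (unliftP ord_max i) => [j|] ->; last by lra.
case: (unliftP ord_max j) => [i'|] ->.
  have bB := shearB N0 m i' : `|shear m i'| <= small.
  have : `|dil i' (X 0 ord_max) * slope (node m) i'| <= 3 * small.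
    by rewrite normrM ler_pM.
  have := h2 i'; rewrite -/(xlast i'); move: bB; rewrite !ler_norml; lra.
have : `|\sum_(i < k) dil i (X 0 ord_max) * slope (node m) i ^+ 2| <=
  k%:R * (3 * (small * small)).
  apply: ler_sum_bound => l; rewrite normrM normrX expr2; apply: ler_pM => //.
  by apply: ler_pM.
have : k%:R * (3 * (small * small)) <= 3 * small.
  rewrite mulrCA ler_pM2l// mulrA ler_piMl ?(ltW c0)//; lra.
move: h3; rewrite !ler_norml; lra.
Qed.

Definition packet_size : R := @amplitude_min R k / 2 * (mesh / 2) ^+ k.+1.

(** Rotating by the phase [A0] at the node makes the integrand nearly real: on the cube, the cosine
    of the remaining phase is at least 1/2, so there is no cancellation. *)
Lemma packet_lower_bound (m : grid) (x : Rn) : packet_tube m x ->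
  packet_size ^+ 2 <= sqmod (oscillatory_op (@phase R k) (@amplitude R k) scale
    (packet m) x).
Proof.
move=> tx.
rewrite oscillatory_opE /sqmod /=.
set I := Rintegral _ _ _; set J := Rintegral _ _ _.
pose A xi := kernel_phase scale (x, xi) + packet_phase m xi.
pose A0 := A (node m).
have AE xi : A xi = - (2 * pi * (scale * F m (scale^-1 *: x) xi)).
  by rewrite /A /kernel_phase /packet_phase /rescaled_phase /F /=; ring.
pose amp xi := rescaled_amplitude scale (@amplitude R k) (x, xi).
have reE xi : kernel_re scale (packet m) (x,
  xi) = cos (A xi) * amp xi * \1_(cube m) xi.
  by rewrite /kernel_re /kernel packetE -/(amp xi) [snd _]/= [complex.Re _]/=
    [complex.Im _]/= /A cosD; ring.
have imE xi : kernel_im scale (packet m) (x,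
  xi) = sin (A xi) * amp xi * \1_(cube m) xi.
  by rewrite /kernel_im /kernel packetE -/(amp xi) [snd _]/= [complex.Re _]/=
    [complex.Im _]/= /A sinD; ring.
have [i1 i2] := kernel_integrable scale x (tame_packet m).
have i1' : (lebesgue_rV k.+1).-integrable setT
  (EFin \o (fun xi => cos A0 * kernel_re scale (packet m) (x, xi))).
  exact: (integrableZl measurableT (cos A0) i1).
have i2' : (lebesgue_rV k.+1).-integrable setT
  (EFin \o (fun xi => sin A0 * kernel_im scale (packet m) (x, xi))).
  exact: (integrableZl measurableT (sin A0) i2).
have IJ : cos A0 * I + sin A0 * J =
    \int[lebesgue_rV k.+1]_xi (cos A0 * kernel_re scale (packet m) (x, xi) +
                              sin A0 * kernel_im scale (packet m) (x, xi)).
  by rewrite RintegralD// !RintegralZl.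
have amin0 := @amplitude_min_gt0 R k.
have mC := measurable_cube m.
have mI : measurable_fun setT (fun xi : Rn1 => (\1_(cube m) xi : R)%:E).
  by apply/measurable_EFinP; exact: measurable_indic.
have muI : (\int[lebesgue_rV k.+1]_xi (\1_(cube m) xi)%:E =
  ((mesh / 2) ^+ k.+1)%:E)%E.
  by rewrite integral_indic// setIT; exact: measure_cube.
have iI : (lebesgue_rV k.+1).-integrable setT (EFin \o (\1_(cube m) : Rn1 -> R)).
  apply/integrableP; split => //.
  by under eq_integral do rewrite gee0_abs ?lee_fin//; rewrite muI ltry.
have lower : packet_size <= cos A0 * I + sin A0 * J.
  rewrite IJ.
  have -> : packet_size = \int[lebesgue_rV k.+1]_xi (@amplitude_min R k / 2 *
    \1_(cube m) xi).
    by rewrite RintegralZl// /Rintegral muI.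
  apply: le_Rintegral => //.
  - exact: (integrableZl measurableT (@amplitude_min R k / 2) iI).
  - exact: (integrableD measurableT i1' i2').
  move=> xi _; rewrite reE imE.
  have -> : cos A0 * (cos (A xi) * amp xi * \1_(cube m) xi) +
    sin A0 * (sin (A xi) * amp xi * \1_(cube m) xi)
     = cos (A xi - A0) * amp xi * \1_(cube m) xi by rewrite cosB; ring.
  rewrite indicE; have [xc|_] := boolP (xi \in cube m); last by rewrite !mulr0.
  rewrite !mulr1; rewrite inE in xc.
  have ha : amplitude_min k <= amp xi.
    apply: amplitude_ge_min => /=; last by have [_ + _] := cubeP xc.
    exact: packet_tube_small tx.
  rewrite mulrC; apply: ler_pM => //; first by rewrite ltW.
  apply: cos_ge_half; rewrite AE /A0 AE -opprB opprK.
  have := packet_phase_variation tx xc; rewrite -normrN; congr (`|_| <= _); ring.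
have p0 : 0 <= packet_size.
  by rewrite mulr_ge0 ?exprn_ge0//; [lra|have := @mesh_gt0 R k N N0; lra].
apply: (@le_trans _ _ ((cos A0 * I + sin A0 * J) ^+ 2)).
  by rewrite ler_sqr ?nnegrE// (le_trans p0).
(* Lagrange's identity: (c^2 + s^2)(I^2 + J^2) - (c I + s J)^2 = (s I - c J)^2. *)
have := cos2Dsin2 A0; have := sqr_ge0 (sin A0 * I - cos A0 * J).
set c := cos A0; set s := sin A0 => h cs.
have -> : I ^+ 2 + J ^+ 2 = (c ^+ 2 + s ^+ 2) * (I ^+ 2 +
  J ^+ 2) by rewrite cs mul1r.
lra.
Qed.
End packet_bound.

(** * Compression of the tubes *)

Section compression.
Context {R : realType} (k N : nat).
Local Notation Rn := 'rV[R]_k.+2.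
Local Notation Rn1 := 'rV[R]_k.+1.
Local Notation grid := {ffun 'I_k.+1 -> 'I_N}.
Local Notation scale := (@scale R N).
Local Notation small := (@small R k).
Local Notation mesh := (@mesh R k N).

Lemma val_xlast (i : 'I_k) : xlast i = i :> nat.
Proof. by rewrite /xlast !lift_max. Qed.

Definition paired (i : nat) : bool := ~~ odd i && (i.+1 < k)%N.

(** Each constraint ties an even coordinate to the next one, hence to later coordinates only, as
    [measure_tube] requires. *)
Definition compression_center (i : 'I_k.+2) (x : Rn) : R :=
  if unlift ord_max i is Some j then
    if unlift ord_max j is Some i' then
      if odd i' then 0 else
      if insub i'.+1 is Some l then
        - (2 + scale^-1 * x 0 ord_max) * x 0 (xlast (l : 'I_k))
      else 0
    else 0
  else 0.

(** The boolean counts as 0 or 1: width N for a constrained coordinate and N^2 = lambda for all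
    others, so each pair saves one factor N. *)
Definition compression_width (i : 'I_k.+2) : R := N%:R ^+ (2 - paired i).

(* All the packet tubes lie in this set: on the pair of coordinates 2j, 2j+1
   the 2 x 2 block of [A + B] has rank one and range [x_2j + (2 + t) x_2j+1 = 0]. *)
Definition compression_set : set Rn := tube compression_center compression_width.

Lemma sum_paired : (\sum_(i < k) paired i)%N = k./2.
Proof.
rewrite /paired; case: k => [|n]; first by rewrite big_ord0.
rewrite big_ord_recr /= ltnn andbF addn0.
under eq_bigr => i _ do rewrite ltnS ltn_ord andbT.
by elim: n => [|n IH]; rewrite ?big_ord0// big_ord_recr /= IH;
  case: (odd n) (odd_double_half n) => /= E; lia.
Qed.

Lemma measurable_time : measurable_fun setT (fun x : Rn => scale^-1 * x 0 ord_max).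
Proof. by apply: measurable_funM => //; exact: measurable_coord. Qed.

Lemma measurable_dil i : measurable_fun setT (fun x : Rn =>
  dil i (scale^-1 * x 0 ord_max)).
Proof.
have m2 : measurable_fun setT (fun x : Rn => 2 + scale^-1 * x 0 ord_max).
  by apply: measurable_funD => //; exact: measurable_time.
rewrite /dil; case: (odd i) => //.
by apply: measurable_funN; exact: (measurableT_comp measurable_inv m2).
Qed.

Lemma measurable_compression_center i : measurable_fun setT (compression_center i).
Proof.
rewrite /compression_center; case: unlift => [j|]; last exact: measurable_cst.
case: unlift => [i'|]; last exact: measurable_cst.
case: (odd _); first exact: measurable_cst.
case: insub => [l|]; last exact: measurable_cst.
apply: measurable_funM; last exact: measurable_coord.
by apply: measurable_funN; apply: measurable_funD => //; exact: measurable_time.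
Qed.

Lemma measurable_tube_center (m : grid) i : measurable_fun setT (@tube_center R k N
  m i).
Proof.
rewrite /tube_center; case: unlift => [j|]; last exact: measurable_cst.
case: unlift => [i'|].
  apply: measurable_funM => //; apply: measurable_funM => //.
  apply: measurable_funD => //; apply: measurable_funM => //; exact: measurable_dil.
apply: measurable_funM => //; apply: measurable_sum => l.
by apply: measurable_funM => //; exact: measurable_dil.
Qed.

Lemma prod_split (F : 'I_k.+2 -> R) : \prod_(i < k.+2) F i =
  F ord_max * (F (lift ord_max ord_max) * \prod_(i < k) F (xlast i)).
Proof. by rewrite (bigD1_ord ord_max)//= (bigD1_ord ord_max). Qed.

Lemma measure_compression_set :
  lebesgue_rV k.+2 compression_set = (2 ^+ k.+2 * N%:R ^+ (k.+2.*2 - k./2))%:E.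
Proof.
rewrite measure_tube; first last.
- by move=> i; rewrite exprn_ge0.
- move=> i x y xy; rewrite /compression_center.
  case: (unliftP ord_max i) xy => [j|] -> // xy;
    case: (unliftP ord_max j) xy => [i'|] -> // xy.
  case: (odd _) => //; case: insubP => [l _ lE|//].
  have e1 : (xlast i' < (ord_max : 'I_k.+2))%N by rewrite val_xlast ltnS ltnW.
  have e2 : (xlast i' < xlast (l : 'I_k))%N.
    by rewrite !val_xlast -[nat_of_ord l]/(val l) lE.
  by rewrite (xy _ e1) (xy _ e2).
- exact: measurable_compression_center.
rewrite big_split /= prodr_const card_ord; congr (_ * _)%:E.
rewrite -expr_sum; congr (_ ^+ _).
have -> : (\sum_(i < k.+2) (2 - paired i))%N = (2 + (2 + \sum_(i <
  k) (2 - paired i)))%N.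
  have p1 : paired k = false by rewrite /paired ltnNge leqnSn andbF.
  have p2 : paired k.+1 = false by rewrite /paired ltnNge leqW// andbF.
  by rewrite !big_ord_recr /= p1 p2 !subn0 -addnA addnC -addnA.
have : (\sum_(i < k) (2 - paired i) + \sum_(i < k) paired i = k.*2)%N.
  rewrite -big_split /= (eq_bigr (fun=> 2%N)) => [|i _]; last by rewrite subnK//;
    case: paired.
  by rewrite sum_nat_const card_ord muln2.
by rewrite sum_paired; lia.
Qed.

Lemma measure_packet_tube (m : grid) :
  lebesgue_rV k.+2 (packet_tube m) = ((2 * small) ^+ k.+2 * N%:R ^+ k.+3)%:E.
Proof.
have c0 := @small_gt0 R k.
rewrite measure_tube; first last.
- by move=> i; rewrite /tube_width; case: ifP => _;
  rewrite mulr_ge0// ?exprn_ge0// ltW.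
- move=> i x y xy; rewrite /tube_center.
  case: (unliftP ord_max i) xy => [j|] -> // xy; rewrite xy//.
  by rewrite lift_max.
- exact: measurable_tube_center.
rewrite prod_split /tube_width eqxx !(eq_sym _ ord_max) (negPf (neq_lift _ _)).
under eq_bigr => i _ do rewrite eq_sym (negPf (neq_lift _ _)).
rewrite prodr_const card_ord; congr (_%:E).
have sE : scale = N%:R * N%:R by rewrite -expr2.
rewrite sE; move: (small) => s.
have -> : (2 * (s * N%:R)) ^+ k = (2 * s) ^+ k * N%:R ^+ k by rewrite -exprMn mulrA.
rewrite (exprS _ k.+2) !(exprS _ k.+1) !(exprS _ k).
by move: ((2 * s) ^+ k) (N%:R ^+ k) => A B; ring.
Qed.

Hypothesis N0 : (0 < N)%N.

(** The row vector (1, 2 + t) annihilates the 2 x 2 block, so in x_2j + (2 + t) x_(2j+1) the slopes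
    cancel and only the tube width remains. *)
Lemma packet_tube_compressed (m : grid) : packet_tube m `<=` compression_set.
Proof.
move=> x tx i; rewrite /compression_center /compression_width.
have s0 := @scale_gt0 R N N0; have c1 := @small_le1 R k; have c0 := @small_gt0 R k.
have r2 := @rad_le R k; have n1 : 1 <= N%:R :> R by rewrite ler1n.
have free j : `|x 0 j| <= N%:R ^+ 2.
  have := packet_tube_small N0 tx j; rewrite mxE normrM normfV (gtr0_norm s0).
  rewrite ler_pdivrMl// => /le_trans; apply.
  by rewrite ler_piMr ?(ltW s0)//; lra.
case: (unliftP ord_max i) => [j|] ->; last first.
  by rewrite subr0 /paired /= ltnNge leqW// andbF.
case: (unliftP ord_max j) => [i'|] ->; last first.
  by rewrite subr0 /paired lift_max /= ltnNge leqnSn andbF.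
rewrite -/(xlast i') val_xlast /paired.
case oi : (odd i') => /=; first by rewrite subr0.
case: insubP => [l lk lE|/negPf ->]; last by rewrite subr0.
rewrite lk subn1 expr1.
have [h1 h2 _] := tubeP N0 tx; set X := scale^-1 *: x in h1 h2.
have XE j' : x 0 j' = scale * X 0 j' by rewrite mxE mulVKf// gt_eqF.
have := h2 i'; have := h2 l.
rewrite /dil /shear lE /= oi /= -lE !node_slopeE /=.
rewrite !XE mulKf ?gt_eqF//.
set t := X 0 ord_max => D2 D1.
have t1 : `|t| <= 1 by lra.
have t2 : 1 <= 2 + t <= 3 by move: t1; rewrite ler_norml; lra.
pose y : R := slope (node m) i'; pose v : R := slope (node m) (l : 'I_k).
rewrite -/y -/v in D1 D2; set P := X 0 (xlast i') in D1 *;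
  set Q := X 0 (xlast l) in D2 *.
(* The left-kernel combination of the two tube equations: each bracket is at most [mesh] and 2 + t
   <= 3, giving 4 mesh, hence 4 small N <= N after rescaling. *)
have -> : scale * P - - (2 + t) * (scale * Q) = scale *
   ((P + 2 * ((2 + t) * y + v)) + (2 + t) * (Q + 2 * (- (2 + t)^-1 * v - y))).
  by field; lra.
rewrite normrM (gtr0_norm s0).
have ND : `|(P + 2 * ((2 + t) * y + v)) + (2 + t) * (Q + 2 * (- (2 +
  t)^-1 * v - y))| <= 4 * mesh.
  apply: (le_trans (ler_normD _ _)); rewrite normrM (ger0_norm (_ : 0 <= 2 + t));
    last by lra.
  have : (2 + t) * `|Q + 2 * (- (2 + t)^-1 * v - y)| <= 3 * mesh by apply: ler_pM =>
    //; lra.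
  lra.
apply: (le_trans (ler_wpM2l (ltW s0) ND)).
by rewrite mulrCA scale_mesh// mulrA ler_piMl//; lra.
Qed.

End compression.

(** * Superposition of the packets *)

Section focusing.
Context {R : realType} (k N : nat).
Local Notation Rn := 'rV[R]_k.+2.
Local Notation Rn1 := 'rV[R]_k.+1.
Local Notation grid := {ffun 'I_k.+1 -> 'I_N}.
Hypothesis N0 : (0 < N)%N.
Local Notation scale := (@scale R N).
Local Notation small := (@small R k).
Local Notation mesh := (@mesh R k N).
Local Notation T f := (oscillatory_op (@phase R k) (@amplitude R k) scale f).

Lemma cube_disjoint (m m' : grid) (xi : Rn1) : cube m xi -> cube m' xi -> m = m'.
Proof.
move=> c c'; apply/ffunP => j; apply/val_inj => /=.
have s0 := @mesh_gt0 R k N N0.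
have : `|(m j)%:R - (m' j)%:R : R| < 1.
  rewrite -(ltr_pM2l s0) mulr1 -[X in X * _](gtr0_norm s0) -normrM.
  have := c j; have := c' j; rewrite !mxE mulrBr !ler_norml ltr_norml; lra.
rewrite ltr_norml => /andP[h1 h2].
have nat_close (a b : nat) : (a < b)%N -> (a%:R : R) + 1 <= b%:R.
  by rewrite natr1 ler_nat.
by case: (ltngtP (m j) (m' j)) => // /nat_close h; exfalso; lra.
Qed.

Definition packet_sum (s : grid -> bool) (xi : Rn1) : R[i] :=
  \sum_(m <- index_enum grid) signed (s m) (packet m xi).

Lemma normc_packet (m : grid) (xi : Rn1) : cube m xi ->
  Normc.normc (packet m xi) = 1.
Proof.
move=> mx; rewrite packetE indicE mem_set//= !mul1r cos2Dsin2.
exact: sqrtr1.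
Qed.

Lemma sqmodE (z : R[i]) : Normc.normc z ^+ 2 = sqmod z.
Proof. by case: z => a b; rewrite sqr_sqrtr ?sqmod_ge0// addr_ge0 ?sqr_ge0. Qed.

Lemma normc_ge0 (z : R[i]) : 0 <= Normc.normc z.
Proof. by case: z => a b; exact: sqrtr_ge0. Qed.

(** As 0 <= f <= 1, raising to a power r >= 1 only decreases f, so every such norm is controlled by
    the measure of [S]. *)
Lemma Lnorm_le1 d (X : measurableType d) (mu : {measure set X -> \bar R})
    (S : set X) (f : X -> R) (r : \bar R) : (1 <= r)%E -> measurable S ->
  (mu S <= 1)%E -> measurable_fun setT f -> (forall x, 0 <= f x <= \1_S x) ->
  (Lnorm mu r (EFin \o f) <= 1)%E.
Proof.
move=> r1 mS S1 mf fS; have f1 x : 0 <= f x <= 1.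
  have /andP[-> h] := fS x; apply: (le_trans h).
  by rewrite indicE; case: (_ \in _).
case: r r1 => [r r1||//].
- rewrite unlock /=; have r0 : 0 < r by rewrite lee_fin in r1; lra.
  apply: (@le_trans _ _ (1 `^ r^-1)%E); last by rewrite poweR1r.
  apply: gt0_ler_poweR; rewrite ?invr_ge0 ?(ltW r0)//.
  + by rewrite in_itv /= leey andbT integral_ge0// => x _; exact: poweR_ge0.
  + by rewrite in_itv /= leey andbT.
  apply: (le_trans _ S1); rewrite -(setIT S) -(integral_indic mu measurableT mS).
  apply: ge0_le_integral => //.
  + apply/measurable_EFinP; apply: (measurableT_comp (measurable_powR r)).
    exact: measurableT_comp.
  + by apply/measurable_EFinP; exact: measurable_indic.
  move=> x _; rewrite lee_fin; have /andP[f0 fx] := fS x.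
  rewrite ger0_norm//; apply: le_trans fx; have /andP[_ f1x] := f1 x.
  have [->|fx0] := eqVneq (f x) 0; first by rewrite powR0// gt_eqF.
  by apply: ge1r_powR; [rewrite lt0r fx0 f0 f1x|rewrite lee_fin in r1].
- move=> _; rewrite unlock; case: ifPn => // _; apply/ess_supP/nearW => x /=.
  by have /andP[f0 h] := f1 x; rewrite lee_fin ger0_norm.
Qed.

(** The cubes are disjoint and the packets unimodular on them, so the signs cannot affect the
    modulus. *)
Lemma normc_packet_sum s xi : Normc.normc (packet_sum s xi) <=
  \1_(@frequency_box R k) xi.
Proof.
have nN (b : bool) (z : R[i]) : Normc.normc (signed b z) = Normc.normc z.
  by case: b => //; case: z => a b /=; rewrite !sqrrN.
case: (pselect (exists m : grid, cube m xi)) => [[m mxi]|none].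
  have xb : frequency_box xi.
    move=> j; have [_ h _] := cubeP N0 mxi; apply: (le_trans (h j)).
    by have := @rad_gt0 R k; lra.
  rewrite indicE mem_set// /packet_sum (bigD1_seq m) ?index_enum_uniq
    ?mem_index_enum//=.
  rewrite big1 ?addr0 ?nN ?normc_packet// => m' m'm.
  have -> : packet m' xi = 0.
    rewrite packetE indicE memNset ?mul0r//.
    by move=> m'xi; move: m'm; rewrite (cube_disjoint m'xi mxi) eqxx.
  by case: (s m') => //=; rewrite oppr0.
rewrite /packet_sum big1 => [|m _]; first by rewrite /= expr0n/= addr0 sqrtr0.
have -> : packet m xi = 0.
  by rewrite packetE indicE memNset ?mul0r// => mxi; apply: none; exists m.
by case: (s m) => //=; rewrite oppr0.
Qed.

Lemma measurable_normc n (f : 'rV[R]_n -> R[i]) : cmeasurable f ->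
  measurable_fun setT (fun x => Normc.normc (f x)).
Proof.
move=> mf; have -> : (fun x => Normc.normc (f x)) = (fun x => sqmod (f x) `^ 2^-1).
  by apply/funext => x; rewrite powR12_sqrt ?sqmod_ge0//; case: (f x).
apply: (measurableT_comp (measurable_powR _)); case: mf => mr mi.
by apply: measurable_funD; exact: measurable_funX.
Qed.

Lemma cLnorm_packet_sum s r : (1 <= r)%E -> cmeasurable (packet_sum s) ->
  (cLnorm r (packet_sum s) <= 1)%E.
Proof.
move=> r1 mf; apply: (Lnorm_le1 r1 (@measurable_frequency_box R k)
  (@measure_frequency_box R k)).
  exact: measurable_normc.
by move=> x; rewrite normc_ge0 normc_packet_sum.
Qed.

(** What is left when powers of N are removed from the number of packets, N^(k+1), times the squared
    packet size, of order N^(-2(k+1)), times the tube measure, of order N^(k+3); the net power is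
    N^2. *)
Definition energy_constant : R :=
  (@amplitude_min R k / 2 * (small / 2) ^+ k.+1) ^+ 2 * (2 * small) ^+ k.+2.

Lemma energy_constant_gt0 : 0 < energy_constant.
Proof.
have c0 := @small_gt0 R k; have a0 := @amplitude_min_gt0 R k.
have h1 : 0 < (small / 2) ^+ k.+1 by apply: exprn_gt0; exact: divr_gt0.
have h2 : 0 < (2 * small) ^+ k.+2 by apply: exprn_gt0; exact: mulr_gt0.
by apply: mulr_gt0 => //; apply: exprn_gt0; apply: mulr_gt0 => //; exact: divr_gt0.
Qed.

Lemma measurable_compression_set : measurable (@compression_set R k N).
Proof. by apply: measurable_tube; exact: measurable_compression_center. Qed.

Lemma measurable_packet_tube (m : grid) : measurable (@packet_tube R k N m).
Proof. by apply: measurable_tube; exact: measurable_tube_center. Qed.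

Lemma packet_energy (m : grid) :
  ((@packet_size R k N ^+ 2 * ((2 * small) ^+ k.+2 * N%:R ^+ k.+3))%:E <=
   energy (@compression_set R k N) (T (packet m)))%E.
Proof.
have mT : measurable_fun setT (fun x => (sqmod (T (packet m) x))%:E).
  apply/measurable_EFinP; apply: measurable_sqmod.
  exact: (cmeasurable_oscillatory_op scale (@tame_packet R k N m)).
have mt := measurable_packet_tube m; have mY := measurable_compression_set.
apply: (@le_trans _ _ (\int[lebesgue_rV k.+2]_(x in packet_tube m) (sqmod (T (packet
  m) x))%:E)%E); last first.
  apply: ge0_subset_integral => //.
  - exact: measurable_funTS.
  - by move=> x _; rewrite lee_fin sqmod_ge0.
  - exact: packet_tube_compressed.
rewrite EFinM -(measure_packet_tube m) -integral_cst//.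
apply: ge0_le_integral => //.
- by move=> x _; rewrite lee_fin sqr_ge0.
- exact: measurable_funTS.
- by move=> x tx; rewrite lee_fin; exact: packet_lower_bound.
Qed.

Lemma focusing_example : exists f : Rn1 -> R[i],
  [/\ tame 1 f, forall r, (1 <= r)%E -> (cLnorm r f <= 1)%E &
     ((energy_constant * N%:R ^+ 2)%:E <= energy (@compression_set R k N) (T f))%E].
Proof.
have [s [ts es]] := sign_choice scale measurable_compression_set
  (index_enum_uniq grid) (@tame_packet R k N).
exists (packet_sum s).
have mf : cmeasurable (packet_sum s) by case: ts.
split.
(* The bound supplied by [sign_choice] grows with the number of packets; disjointness of the cubes
   improves it to 1. *)
- split => // xi; have := normc_packet_sum s xi => h.
  have {}h : Normc.normc (packet_sum s xi) <= 1.
    by apply: (le_trans h); rewrite indicE; case: (_ \in _).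
  have : sqmod (packet_sum s xi) <= 1 by rewrite -sqmodE expr_le1// normc_ge0.
  have le1 (y : R) : y ^+ 2 <= 1 -> `|y| <= 1.
    by rewrite -real_normK ?num_real// expr_le1.
  have := sqr_ge0 (complex.Re (packet_sum s xi));
    have := sqr_ge0 (complex.Im (packet_sum s xi)).
  by rewrite /sqmod => h1 h2 h3; split; apply: le1; lra.
- by move=> r r1; exact: cLnorm_packet_sum.
apply: le_trans es.
have -> : (energy_constant * N%:R ^+ 2)%:E =
    (\sum_(m <- index_enum grid) (@packet_size R k N ^+ 2 * ((2 * small) ^+ k.+2 *
      N%:R ^+ k.+3))%:E)%E.
  rewrite sumEFin; congr (_%:E).
  rewrite [RHS](_ : _ = (@packet_size R k N ^+ 2 * ((2 * small) ^+ k.+2 * N%:R ^+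
    k.+3)) *+ #|grid|); last first.
    by rewrite -sumr_const; apply: eq_bigl.
  rewrite card_ffun !card_ord -(mulr_natr _ (N ^ k.+1)) natrX.
  rewrite /packet_size (_ : mesh / 2 = small / 2 / N%:R);
    last by rewrite /mesh mulrAC.
  rewrite expr_div_n (_ : N%:R ^+ k.+3 = N%:R ^+ k.+1 * N%:R ^+ 2);
    last by rewrite -exprD addn2.
  rewrite /energy_constant.
  have : N%:R ^+ k.+1 != 0 :> R by rewrite expf_neq0// pnatr_eq0 -lt0n.
  move: (N%:R ^+ k.+1) (N%:R ^+ 2) ((small / 2) ^+ k.+1) ((2 * small) ^+ k.+2)
    (amplitude_min k).
  by move=> a b c d e a0; field.
by apply: lee_sum => m _; exact: packet_energy.
Qed.
End focusing.

(** * Conclusion *)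

Section conclusion.
Context {R : realType}.

Lemma powR_growth (A D s : R) : 0 < A -> s < 2 ->
  ~ (forall N : nat, (0 < N)%N -> A * N%:R ^+ 2 <= D * N%:R `^ s).
Proof.
move=> A0 s2 H; have d0 : 0 < 2 - s by lra.
pose M := (`|D| / A + 1) `^ (2 - s)^-1.
have M0 : 0 <= M by exact: powR_ge0.
pose N := (Num.bound M).+1.
have MN : M < N%:R by apply: (lt_trans (archi_boundP M0)); rewrite ltr_nat.
have N0 : 0 < N%:R :> R by rewrite ltr0n.
have D0 : 0 < `|D| / A + 1 by rewrite ltr_wpDl// divr_ge0// ltW.
have big : `|D| / A + 1 < N%:R `^ (2 - s).
  rewrite (_ : `|D| / A + 1 = M `^ (2 - s)); last first.
    by rewrite /M -powRrM mulVf ?powRr1 ?(ltW D0)//; lra.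
  by rewrite gt0_ltr_powR// nnegrE// ltW.
have := H N isT; rewrite -(@powR_mulrn _ _ 2%N (ltW N0)).
rewrite (_ : 2%:R = (2 - s) + s :> R); last by ring.
rewrite powRD; last by apply/implyP => _; rewrite gt_eqF.
rewrite mulrA ler_pM2r ?powR_gt0// => AD.
have : A * (`|D| / A + 1) < A * N%:R `^ (2 - s) by rewrite ltr_pM2l.
rewrite mulrDr mulr1 mulrCA mulfV ?gt_eqF// mulr1.
have := ler_norm D; lra.
Qed.

(** Above the threshold [V], split u^2 = u^(2-q') u^(q'-q) u^q: the first exponent is nonpositive,
    so u > V bounds that factor, and the second is nonnegative, so u <= 8 does. Taking q' = max(q,
    2) treats q < 2 and q >= 2 together. *)
Lemma sqr_le_powR (u V q q' : R) : 0 <= u <= 8 -> 0 < V -> q <= q' -> 2 <= q' ->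
  u ^+ 2 <= V `^ (2 - q') * 8 `^ (q' - q) * u `^ q + V ^+ 2.
Proof.
move=> /andP[u0 u8] V0 qq q2.
have [uV|Vu] := leP u V.
  by rewrite ler_wpDl ?mulr_ge0 ?powR_ge0// ler_sqr ?nnegrE// ltW.
have up : 0 < u by exact: lt_trans Vu.
apply: ler_wpDr; first exact: sqr_ge0.
have u2 : u ^+ 2 = u `^ (2 - q' + (q' - q) + q).
  by rewrite -powR_mulrn//; congr (_ `^ _); ring.
rewrite {}u2.
have pD a b : u `^ (a + b) = u `^ a * u `^ b.
  by rewrite powRD//; apply/implyP => _; rewrite gt_eqF.
rewrite (pD (2 - q' + (q' - q)) q) (pD (2 - q') (q' - q)).
rewrite ler_wpM2r ?powR_ge0// ler_pM ?powR_ge0//.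
  rewrite -(opprB q') !powRN lef_pV2 ?posrE ?powR_gt0//.
  by apply: ge0_ler_powR; rewrite ?nnegrE ?subr_ge0//; exact: ltW.
by apply: ge0_ler_powR; rewrite ?nnegrE ?subr_ge0.
Qed.

Lemma energy_le (k : nat) (Y : set 'rV[R]_k.+2) (F : 'rV[R]_k.+2 ->
  R[i]) (q q' B V : R) :
  q <= q' -> 2 <= q' -> measurable Y -> cmeasurable F -> (forall x,
    sqmod (F x) <= 8) -> 0 < V ->
  (\int[lebesgue_rV k.+2]_x (Normc.normc (F x) `^ q)%:E <= B%:E)%E ->
  (energy Y F <= (V `^ (2 - q') * 8 `^ (q' - q) * B)%:E +
    (V ^+ 2)%:E * lebesgue_rV k.+2 Y)%E.
Proof.
move=> qq q2 mY mF F8 V0 FB; pose D := V `^ (2 - q') * 8 `^ (q' - q).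
have D0 : 0 <= D by rewrite mulr_ge0 ?powR_ge0.
have mq : measurable_fun setT (fun x => (Normc.normc (F x) `^ q)%:E).
  apply/measurable_EFinP; apply: (measurableT_comp (measurable_powR q)).
  exact: measurable_normc.
apply: (@le_trans _ _ (\int[lebesgue_rV k.+2]_(x in Y) (D%:E * (Normc.normc (F x) `^
  q)%:E + (V ^+ 2)%:E)))%E.
  apply: ge0_le_integral => //.
  - by move=> x _; rewrite lee_fin sqmod_ge0.
  - by apply/measurable_EFinP; exact: measurable_sqmod.
  - apply: emeasurable_funD => //; apply: measurable_funTS.
    by apply: emeasurable_funM.
  move=> x _; rewrite -EFinM -EFinD lee_fin -sqmodE.
  apply: sqr_le_powR => //; rewrite normc_ge0 /= -ler_sqr ?nnegrE ?normc_ge0//.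
  by rewrite sqmodE; apply: (le_trans (F8 x)); lra.
rewrite ge0_integralD//; first last.
- by move=> x _; rewrite lee_fin sqr_ge0.
- by apply: measurable_funTS; exact: emeasurable_funM.
- by move=> x _; rewrite -EFinM lee_fin mulr_ge0// powR_ge0.
rewrite integral_cst// leeD2r// ge0_integralZl_EFin//; first last.
- exact: measurable_funTS.
- by move=> x _; rewrite lee_fin powR_ge0.
rewrite -/D [leRHS]EFinM; apply: lee_wpmul2l; first by rewrite lee_fin.
apply: le_trans FB.
apply: ge0_subset_integral => //.
by move=> x _; rewrite lee_fin powR_ge0.
Qed.

End conclusion.

Theorem proposition1p3 (R : realType) (k : nat) (n := k.+2)
  (n_ge3 : (3 <= n)%N) (p r : \bar R)
  (p_ge1 : (1 <= p)%E) (r_ge1 : (1 <= r)%E)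
  (p_lt : (p < (if odd n then 2 + 8 / (3 * n%:R - 1)
                else 2 + 8 / (3 * n%:R - 2))%:E)%E)
  (r_le : (hoelder_conjugate r <= ((n%:R - 2) / n%:R)%:E * p)%E) :
  exists phi a : 'rV[R]_n * 'rV[R]_n.-1 -> R,
    [/\ is_amplitude a, cinematic_curvature phi a &
      ~ exists C : R, forall (lambda : R) (f : 'rV[R]_n.-1 -> R[i]),
          1 <= lambda -> in_Lp r f ->
          (cLnorm p (oscillatory_op phi a lambda f) <= C%:E * cLnorm r f)%E].
Proof.
exists (@phase R k), (@amplitude R k); split; first exact: amplitudeP.
  by split; [exact: phase_H1|apply: phase_H2|apply: phase_H3]; exact: amplitudeP.
move=> [C HC].
have [q pq] : exists q : R, p = q%:E.
  by case: p p_ge1 p_lt {r_le HC} => [q _ _|//|//]; exists q.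
rewrite {}pq in p_ge1 p_lt HC; rewrite lee_fin in p_ge1.
(* The set has measure of order N^(e+2) and the energy is of order N^2, so the squared threshold is
   of order N^(-e). Half of each denominator in the hypothesis on [p] is this [e]. *)
pose e : nat := (k.+2.*2 - k./2 - 2)%N.
have eD : (k.+2.*2 - k./2 = e + 2)%N.
  by rewrite /e; have := odd_double_half k; move: (k./2) => m; lia.
have eE : e%:R = (if odd n then 3 * n%:R - 1 else 3 * n%:R - 2) / 2 :> R.
  rewrite /e /n /= negbK; have := odd_double_half k.
  move: (odd k) (k./2) => b m <-.
  have -> : (((b + m.*2).+2).*2 - m - 2 = 3 * m + 2 * b + 2)%N by lia.
  have -> : (b + m.*2).+2%:R = b%:R + 2 * m%:R + 2 :> R.
    by rewrite -(addn2 (b + m.*2)) !natrD -muln2 natrM; ring.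
  by rewrite (natrD _ (3 * m + 2 * b)) (natrD _ (3 * m)) !natrM; case: b => /=;
    field.
have e0 : 0 < e%:R :> R.
  by rewrite ltr0n /e; have := odd_double_half k; move: (k./2) => m; lia.
pose q' := Num.max q 2.
have q'2 : 2 <= q' by rewrite le_max lexx orbT.
have qq : q <= q' by rewrite le_max lexx.
have s2 : e%:R / 2 * (q' - 2) < 2.
  have q'lt : q' < 2 + 4 / e%:R.
    rewrite gt_max [X in _ && X]ltrDl divr_gt0// andbT.
    have h4 (y : R) : 0 < y / 2 -> 8 / y = 4 / (y / 2).
      by move=> y0; field; rewrite gt_eqF//; lra.
    by move: p_lt e0; rewrite lte_fin eE; case: ifP => _ ql /h4 <-.
  rewrite mulrAC ltr_pdivrMr// mulrC -ltr_pdivlMr//; lra.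
(* [C] could be negative; its positive part is a bound that can be raised to the power [q]. *)
pose B := Num.max C 0 `^ q.
pose A := @energy_constant R k.
have A0 : 0 < A := @energy_constant_gt0 R k.
(* Chosen so that [V ^+ 2] times the measure of [compression_set] is exactly [A / 2 * N%:R ^+ 2],
   half of the guaranteed energy. *)
pose w := Num.sqrt (A / 2 ^+ k.+3).
have w2 : w ^+ 2 = A / 2 ^+ k.+3 by rewrite sqr_sqrtr// divr_ge0 ?ltW ?exprn_gt0.
have w0 : 0 < w by rewrite sqrtr_gt0 divr_gt0// exprn_gt0.
apply: (@powR_growth R (A / 2) (w `^ (2 - q') * 8 `^ (q' - q) * B) _ _ s2).
  by lra.
move=> N N0.
have NR : 0 < N%:R :> R by rewrite ltr0n.
have [f [tf fr Ef]] := @focusing_example R k N N0.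
have Lr : in_Lp r f.
  by split; [case: tf|apply: le_lt_trans (fr r r_ge1) _; exact: ltry].
have := HC (@scale R N) f (@scale_ge1 R N N0) Lr.
set F := oscillatory_op _ _ _ _ => FC.
have mF : cmeasurable F := cmeasurable_oscillatory_op (@scale R N) tf.
have qgt0 : 0 < q := lt_le_trans ltr01 p_ge1.
have q0 : q != 0 by rewrite gt_eqF.
have FB : (\int[lebesgue_rV k.+2]_x (Normc.normc (F x) `^ q)%:E <= B%:E)%E.
  have -> : (\int[lebesgue_rV k.+2]_x (Normc.normc (F x) `^ q)%:E =
    cLnorm q%:E F `^ q)%E.
    rewrite /cLnorm poweR_Lnorm//; apply: eq_integral => x _.
    by rewrite /= ger0_norm ?normc_ge0.
  have FC' : (cLnorm q%:E F <= (Num.max C 0)%:E)%E.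
    apply: (le_trans FC); apply: (@le_trans _ _ ((Num.max C 0)%:E * cLnorm r f)%E).
      by rewrite lee_wpmul2r ?lee_fin ?le_max ?lexx// Lnorm_ge0.
    by rewrite -[leRHS]mule1 lee_wpmul2l ?fr// lee_fin le_max lexx orbT.
  rewrite /B -poweR_EFin gt0_ler_poweR//.
  - exact: ltW.
  - by rewrite in_itv /= leey andbT Lnorm_ge0.
  - by rewrite in_itv /= leey andbT lee_fin le_max lexx orbT.
(* As [f] is [tame 1], both parts of [F x] are at most 2 in absolute value, and 8 = 4 + 4. *)
have F8 x : sqmod (F x) <= 8.
  have [h1 h2] := oscillatory_op_bound (@scale R N) x tf.
  rewrite /sqmod -(real_normK (num_real (complex.Re _))) -(real_normK (num_real
    (complex.Im _))).
  have sq (y : R) : `|y| <= 2 * 1 -> `|y| ^+ 2 <= 4.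
    move=> hy; rewrite (_ : 4 = (2 * 1) ^+ 2 :> R); last by ring.
    by rewrite ler_sqr ?nnegrE// mulr1.
  by rewrite (_ : 8 = 4 + 4 :> R) ?lerD ?sq//; ring.
pose V := w * N%:R `^ (- (e%:R / 2)).
have V0 : 0 < V by rewrite mulr_gt0// powR_gt0.
have := le_trans Ef (energy_le qq q'2 (@measurable_compression_set R k N) mF F8 V0
  FB).
rewrite measure_compression_set.
rewrite -EFinM -EFinD lee_fin -/A.
have V2 : V ^+ 2 * (2 ^+ k.+2 * N%:R ^+ (k.+2.*2 - k./2)) = A / 2 * N%:R ^+ 2.
  rewrite eD.
  have NN : (N%:R `^ (- (e%:R / 2))) ^+ 2 = (N%:R ^+ e)^-1 :> R.
    rewrite -powR_mulrn ?powR_ge0// -powRrM.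
    rewrite (_ : - (e%:R / 2) * 2%:R = - e%:R); last by field.
    by rewrite powRN powR_mulrn// ltW.
  rewrite exprMn w2 NN exprD (exprS 2 k.+2).
  have N1 : N%:R ^+ e != 0 :> R by rewrite expf_neq0// gt_eqF.
  have T1 : 2 ^+ k.+2 != 0 :> R by rewrite expf_neq0.
  by move: (N%:R ^+ e) (2 ^+ k.+2) N1 T1 => a b a0 b0; field; rewrite a0 b0.
rewrite V2 => H.
have -> : w `^ (2 - q') * 8 `^ (q' - q) * B * N%:R `^ (e%:R / 2 * (q' - 2)) =
    V `^ (2 - q') * 8 `^ (q' - q) * B.
  rewrite /V powRM ?powR_ge0 ?(ltW w0)// -powRrM.
  rewrite (_ : - (e%:R / 2) * (2 - q') = e%:R / 2 * (q' - 2)); last by ring.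
  by ring.
rewrite -lerBlDr in H; apply: le_trans H.
by rewrite -mulrBl (_ : A - A / 2 = A / 2)//; field.
Qed.
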